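(* Let $\mathcal{A}_i=(\underline{x}_i,\underline{\mathrm{ex}}_i,B_i,G_i)$, $i=1,2$, be graded (skew-symmetric) cluster algebras over a field $\mathbb{K}$, with all frozen variables invertible, such that there exist frozen variables $x\in\underline{x}_1\setminus\underline{\mathrm{ex}}_1$ and $y\in\underline{x}_2\setminus\underline{\mathrm{ex}}_2$, both of degree $1$ (that is, $(G_1)_x=(G_2)_y=1$). Let $\mathcal{A}_1\Box\mathcal{A}_2$ be the graded cluster algebra obtained by gluing $x$ and $y$, with $z$ the new frozen variable replacing $x$ and $y$. Then the map $\varphi:\mathcal{A}_1\Box\mathcal{A}_2\to\mathcal{A}_1\,\overline{\otimes}\,\mathcal{A}_2$ to the Segre product given on initial cluster variables by $$\varphi(x_j)=x_j\otimes y^{\deg x_j}\quad\text{for } x_j\in\underline{x}_1\setminus\{x\},$$ $$\varphi(y_j)=x^{\deg y_j}\otimes y_j\quad\text{for } y_j\in\underline{x}_2\setminus\{y\},$$ $$\varphi(z)=x\otimes y$$ is a graded $\mathbb{K}$-algebra isomorphism. Moreover, every cluster of $\mathcal{A}_1\Box\mathcal{A}_2$ has the form $\underline{x}_1'\Box\underline{x}_2'$ with $\underline{x}_i'$ a cluster of $\mathcal{A}_i$, and for each such cluster one has $\varphi(\iota_1(u))=u\otimes y^{\deg u}$ for all $u\in\underline{x}_1'\setminus\{x\}$, $\varphi(\iota_2(v))=x^{\deg v}\otimes v$ for all $v\in\underline{x}_2'\setminus\{y\}$, and $\varphi(z)=x\otimes y$, where $\iota_1,\iota_2$ are the natural identifications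 of elements of $\mathcal{A}_1,\mathcal{A}_2$ with elements of $\mathcal{A}_1\Box\mathcal{A}_2$.
   Context: Graded cluster algebras. Fix a field $\mathbb{K}$; all algebras are $\mathbb{K}$-algebras and $\otimes=\otimes_{\mathbb{K}}$. A graded (skew-symmetric) cluster algebra $\mathcal{A}=(\underline{x},\underline{\mathrm{ex}},B,G)$ is given by: an initial cluster $\underline{x}$, a finite set of $n$ algebraically independent indeterminates over $\mathbb{K}$; a proper subset $\underline{\mathrm{ex}}\subsetneq\underline{x}$ of mutable variables (elements of $\underline{x}\setminus\underline{\mathrm{ex}}$ are called frozen); an integer exchange matrix $B$ with rows indexed by $\underline{x}$ and columns indexed by $\underline{\mathrm{ex}}$, whose principal part (rows indexed by $\underline{\mathrm{ex}}$) is skew-symmetric; and a grading vector $G\in\mathbb{Z}^n$ (entries indexed by $\underline{x}$) with $B^TG=0$. Mutation of a seed at a mutable variable $x_k$ replaces $x_k$ by $\mu_k(x_k)=\frac{1}{x_k}\left(\prod_j x_j^{[B_{jk}]_+}+\prod_j x_j^{[B_{jk}]_-}\right)$, where $[n]_+=\max\{n,0\}$ and $[n]_-=\max\{-n,0\}$, and replaces $B$ by its usual Fomin–Zelevinsky matrix mutation. Clusters are the sets obtained from $\underline{x}$ by finite sequences of mutations at mutable variables (they all contain the frozen variables), and cluster variables are the elements of clusters (including the frozen variables). The cluster algebra $\mathcal{A}$ is the $\mathbb{K}$-subalgebra of the field $\mathbb{K}(\underline{x})$ generated by all cluster variables and the inverses of all frozen variables. Setting $\deg x_j=G_{x_j}$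 on the initial cluster makes $\mathcal{A}$ a $\mathbb{Z}$-graded algebra in which every cluster variable is homogeneous; $\deg$ denotes the resulting degree and $\mathcal{A}_d$ denotes the degree $d$ component of $\mathcal{A}$. Gluing. Let $\mathcal{A}_i=(\underline{x}_i,\underline{\mathrm{ex}}_i,B_i,G_i)$, $i=1,2$, be graded cluster algebras, with $\underline{x}_1$ and $\underline{x}_2$ regarded as disjoint, and let $x\in\underline{x}_1\setminus\underline{\mathrm{ex}}_1$, $y\in\underline{x}_2\setminus\underline{\mathrm{ex}}_2$ be frozen with $(G_1)_x=(G_2)_y$. Let $z$ be a new variable. For a matrix $B$ write $B^x$ for its row indexed by $x$ and $\widehat{B}^x$ for $B$ with this row removed; for a vector $G$ write $\widehat{G}^x$ for $G$ with the entry indexed by $x$ removed. The graded cluster algebra $\mathcal{A}_1\Box\mathcal{A}_2$ has initial cluster $\underline{x}_1\Box\underline{x}_2=(\underline{x}_1\setminus\{x\})\cup(\underline{x}_2\setminus\{y\})\cup\{z\}$, mutable variables $\underline{\mathrm{ex}}_1\cup\underline{\mathrm{ex}}_2$, initial exchange matrix $$B_1\Box B_2=\begin{bmatrix}\widehat{B}_1^x & 0\\ 0&\widehat{B}_2^y\\ B_1^x & B_2^y\end{bmatrix}$$ (the last row being indexed by $z$), and initial grading vector with entries $\widehat{G}_1^x$, $\widehat{G}_2^y$, and $(G_1)_x=(G_2)_y$ at $z$. Let $\iota_1:\mathbb{K}(\underline{x}_1)\to\mathbb{K}(\underline{x}_1\Box\underline{x}_2)$ be the field embedding fixing $\underline{x}_1\setminus\{x\}$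 and sending $x\mapsto z$, and let $\iota_2:\mathbb{K}(\underline{x}_2)\to\mathbb{K}(\underline{x}_1\Box\underline{x}_2)$ be the field embedding fixing $\underline{x}_2\setminus\{y\}$ and sending $y\mapsto z$. For clusters $\underline{x}_1'$ of $\mathcal{A}_1$ and $\underline{x}_2'$ of $\mathcal{A}_2$, write $\underline{x}_1'\Box\underline{x}_2'=(\underline{x}_1'\setminus\{x\})\cup(\underline{x}_2'\setminus\{y\})\cup\{z\}$, where cluster variables of $\mathcal{A}_1$, $\mathcal{A}_2$ are identified with elements of $\mathbb{K}(\underline{x}_1\Box\underline{x}_2)$ via $\iota_1$, $\iota_2$. Segre product. For $\mathbb{Z}$-graded $\mathbb{K}$-algebras $A=\bigoplus_{i\in\mathbb{Z}}A_i$ and $B=\bigoplus_{i\in\mathbb{Z}}B_i$, the Segre product is the graded algebra $A\,\overline{\otimes}\,B=\bigoplus_{i\in\mathbb{Z}}A_i\otimes_{\mathbb{K}}B_i$, with degree $i$ component $A_i\otimes B_i$ and the usual tensor product multiplication (a subalgebra of $A\otimes B$). *)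

(* Defs.v *)
From HB Require Import structures.
From mathcomp Require Import all_boot all_order all_algebra.
From mathcomp Require Import fraction finmap.
From mathcomp Require Import boolp.
From mathcomp Require Import mpoly ring zify.

Set Implicit Arguments.
Unset Strict Implicit.
Unset Printing Implicit Defensive.

Import GRing.Theory Num.Theory.
Local Open Scope ring_scope.
Local Open Scope quotient_scope.

(* The tensor product of two commutative K-algebras: finite formal sums of pure
   tensors, two of them being identified when every K-bilinear map takes the
   same value on both, i.e. when they differ by the bilinearity relations.
   tensor_universal below is the universal property.  Only a comPzRingType
   structure is declared next to the K-module one, because algType would require
   a proof that 1 != 0; tscalerAl is the missing algebra axiom. *)
Section Tensor.
Variables (K : fieldType) (A B : comAlgType K).

Definition bilinear_map (V : lmodType K) (f : A -> B -> V) :=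
  (forall b, linear (f^~ b)) /\ (forall a, linear (f a)).

Definition formal_eval (V : lmodType K) (f : A -> B -> V) (s : seq (A * B)) : V :=
  \sum_(p <- s) f p.1 p.2.

Definition formal_eqv : rel (seq (A * B)) := fun s t =>
  `[< forall (V : lmodType K) (f : A -> B -> V),
        bilinear_map f -> formal_eval f s = formal_eval f t >].

Lemma formal_eqv_refl : reflexive formal_eqv.
Proof. by move=> s; apply/asboolP. Qed.

Lemma formal_eqv_sym : ssrbool.symmetric formal_eqv.
Proof.
suff im s t : formal_eqv s t -> formal_eqv t s by move=> s t; apply/idP/idP; exact: im.
by move/asboolP => h; apply/asboolP => V f /h.
Qed.

Lemma formal_eqv_trans : transitive formal_eqv.
Proof.
move=> t s r /asboolP h1 /asboolP h2; apply/asboolP => V f bf.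
by rewrite h1 ?h2.
Qed.

Canonical formal_eqv_equiv :=
  EquivRel formal_eqv formal_eqv_refl formal_eqv_sym formal_eqv_trans.

Definition tensor := {eq_quot formal_eqv}.
HB.instance Definition _ := Choice.on tensor.
HB.instance Definition _ := EqQuotient.on tensor.

Definition tens (a : A) (b : B) : tensor := \pi_tensor [:: (a, b)].

Definition tlift (V : lmodType K) (f : A -> B -> V) (t : tensor) : V :=
  formal_eval f (repr t).

Lemma tlift_pi (V : lmodType K) (f : A -> B -> V) s :
  bilinear_map f -> tlift f (\pi_tensor s) = formal_eval f s.
Proof.
move=> bf; have : repr (\pi_tensor s) = s %[mod tensor] by rewrite reprK.
by move/eqquotP/asboolP; apply.
Qed.

Lemma tensorP (t u : tensor) :
  (forall (V : lmodType K) (f : A -> B -> V), bilinear_map f -> tlift f t = tlift f u)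
  -> t = u.
Proof.
move=> h; rewrite -[t]reprK -[u]reprK; apply/eqquotP/asboolP => V f bf.
exact: h.
Qed.

Definition tzero : tensor := \pi_tensor [::].
Definition tadd (t u : tensor) : tensor := \pi_tensor (repr t ++ repr u).
Definition topp (t : tensor) : tensor :=
  \pi_tensor [seq (- p.1, p.2) | p <- repr t].
Definition tscale (c : K) (t : tensor) : tensor :=
  \pi_tensor [seq (c *: p.1, p.2) | p <- repr t].
Definition tone : tensor := tens 1 1.
Definition tmul (t u : tensor) : tensor :=
  \pi_tensor [seq (p.1 * q.1, p.2 * q.2) | p <- repr t, q <- repr u].

Section Lift.
Variables (V : lmodType K) (f : A -> B -> V) (bf : bilinear_map f).

Let fl b : {linear A -> V} := HB.pack (f^~ b) (GRing.isLinear.Build _ _ _ _ _ (bf.1 b)).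
Let fr a : {linear B -> V} := HB.pack (f a) (GRing.isLinear.Build _ _ _ _ _ (bf.2 a)).

Lemma bilinN a b : f (- a) b = - f a b. Proof. exact: (linearN (fl b)). Qed.
Lemma bilinZl c a b : f (c *: a) b = c *: f a b.
Proof. exact: (linearZ_LR (fl b)). Qed.
Lemma bilinZr c a b : f a (c *: b) = c *: f a b.
Proof. exact: (linearZ_LR (fr a)). Qed.

Lemma tlift_tens a b : tlift f (tens a b) = f a b.
Proof. by rewrite tlift_pi // /formal_eval big_seq1. Qed.
Lemma tlift0 : tlift f tzero = 0.
Proof. by rewrite tlift_pi // /formal_eval big_nil. Qed.
Lemma tliftD t u : tlift f (tadd t u) = tlift f t + tlift f u.
Proof. by rewrite tlift_pi // /formal_eval big_cat. Qed.
Lemma tliftN t : tlift f (topp t) = - tlift f t.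
Proof.
by rewrite tlift_pi // /tlift /formal_eval big_map -sumrN; apply: eq_bigr => p _; rewrite bilinN.
Qed.
Lemma tliftZ c t : tlift f (tscale c t) = c *: tlift f t.
Proof.
by rewrite tlift_pi // /tlift /formal_eval big_map scaler_sumr; apply: eq_bigr => p _; rewrite bilinZl.
Qed.
Lemma tliftM t u :
  tlift f (tmul t u) = tlift (fun a b => tlift (fun a' b' => f (a * a') (b * b')) u) t.
Proof. by rewrite tlift_pi // /tlift /formal_eval big_allpairs_dep. Qed.

Lemma bilinear_mulr u :
  bilinear_map (fun a b => tlift (fun a' b' => f (a * a') (b * b')) u).
Proof.
split=> [b c a a'|a c b b']; rewrite /tlift /formal_eval /= scaler_sumr -big_split;
  apply: eq_bigr => p _ /=.
- by rewrite mulrDl -scalerAl (bf.1).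
- by rewrite mulrDl -scalerAl (bf.2).
Qed.

Lemma bilinear_mull a b : bilinear_map (fun a' b' => f (a * a') (b * b')).
Proof.
split=> [b' c a' a''|a' c b' b''] /=.
- by rewrite mulrDr -scalerAr (bf.1).
- by rewrite mulrDr -scalerAr (bf.2).
Qed.
End Lift.

Lemma taddA : associative tadd.
Proof. by move=> t u v; apply: tensorP => V f bf; rewrite !tliftD // addrA. Qed.
Lemma taddC : commutative tadd.
Proof. by move=> t u; apply: tensorP => V f bf; rewrite !tliftD // addrC. Qed.
Lemma tadd0 : left_id tzero tadd.
Proof. by move=> t; apply: tensorP => V f bf; rewrite tliftD // tlift0 // add0r. Qed.
Lemma taddN : left_inverse tzero topp tadd.
Proof. by move=> t; apply: tensorP => V f bf; rewrite tliftD // tliftN // tlift0 // addNr. Qed.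

HB.instance Definition _ := GRing.isZmodule.Build tensor taddA taddC tadd0 taddN.

Lemma tscaleA c d t : tscale c (tscale d t) = tscale (c * d) t.
Proof. by apply: tensorP => V f bf; rewrite !tliftZ // scalerA. Qed.
Lemma tscale1 : left_id 1 tscale.
Proof. by move=> t; apply: tensorP => V f bf; rewrite tliftZ // scale1r. Qed.
Lemma tscaleDr : right_distributive tscale +%R.
Proof. by move=> c t u; apply: tensorP => V f bf; rewrite !(tliftD,tliftZ) // scalerDr. Qed.
Lemma tscaleDl t : {morph tscale^~ t : c d / c + d}.
Proof. by move=> c d; apply: tensorP => V f bf; rewrite !(tliftD,tliftZ) // scalerDl. Qed.

HB.instance Definition _ :=
  GRing.Zmodule_isLmodule.Build K tensor tscaleA tscale1 tscaleDr tscaleDl.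

Lemma tmulC : commutative tmul.
Proof.
move=> t u; apply: tensorP => V f bf; rewrite !tliftM // /tlift /formal_eval exchange_big /=.
by apply: eq_bigr => p _; apply: eq_bigr => q _; rewrite mulrC (mulrC q.2).
Qed.
Lemma tmul1 : left_id tone tmul.
Proof.
move=> t; apply: tensorP => V f bf; rewrite tliftM // tlift_tens; last exact: bilinear_mulr.
by apply: eq_bigr => p _; rewrite !mul1r.
Qed.
Lemma tmulA : associative tmul.
Proof.
move=> t u v; apply: tensorP => V f bf; rewrite !tliftM //; last exact: bilinear_mulr.
apply: eq_bigr => p _; rewrite tliftM; last exact: bilinear_mull.
by apply: eq_bigr => q _; apply: eq_bigr => r _; rewrite !mulrA.
Qed.
Lemma tmulDl : left_distributive tmul +%R.
Proof.
move=> t u v; apply: tensorP => V f bf.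
by rewrite !(tliftM, tliftD) //; exact: bilinear_mulr.
Qed.

HB.instance Definition _ :=
  GRing.Zmodule_isComPzRing.Build tensor tmulA tmulC tmul1 tmulDl.

Lemma tscalerAl c (t u : tensor) : c *: (t * u) = (c *: t) * u.
Proof.
apply: tensorP => V f bf; rewrite tliftZ // !tliftM // tliftZ //; exact: bilinear_mulr.
Qed.

Lemma tens_bilinear : bilinear_map tens.
Proof.
split=> [b c a a'|a c b b']; apply: tensorP => V f bf;
  by rewrite tliftD // tliftZ // !tlift_tens // (bf.1, bf.2).
Qed.

Lemma tensM a b a' b' : tens a b * tens a' b' = tens (a * a') (b * b').
Proof.
apply: tensorP => V f bf; rewrite tliftM // !tlift_tens //; first exact: bilinear_mull.
exact: bilinear_mulr.
Qed.

Lemma tens1 : tens 1 1 = 1. Proof. by []. Qed.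

Lemma tensor_universal (V : lmodType K) (f : A -> B -> V) : bilinear_map f ->
  exists! g : tensor -> V, linear g /\ (forall a b, g (tens a b) = f a b).
Proof.
move=> bf; exists (tlift f); split; first split.
- by move=> c t u; rewrite tliftD // tliftZ.
- by move=> a b; rewrite tlift_tens.
move=> g [lg gE]; apply/funext => t; rewrite -[t in RHS]reprK /tlift.
pose gl : {linear tensor -> V} := HB.pack g (GRing.isLinear.Build _ _ _ _ _ lg).
elim: (repr t) => [|p s ih]; rewrite /formal_eval.
  by rewrite big_nil; apply/esym/(linear0 gl).
rewrite big_cons -/(formal_eval f s) ih.
suff -> : \pi_tensor (p :: s) = tens p.1 p.2 + \pi_tensor s.
  by rewrite -[tens _ _]scale1r lg scale1r gE.
apply: tensorP => W h bh; rewrite tliftD // tlift_tens // !tlift_pi //.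
by rewrite /formal_eval big_cons.
Qed.

End Tensor.

Section Segre.
Variables (K : fieldType) (A B : comAlgType K).
Variables (grA : int -> A -> Prop) (grB : int -> B -> Prop).

(* The image of A_d (x) B_d in A (x) B, which is A_d (x) B_d as K is a field. *)
Inductive segre_comp (d : int) : tensor A B -> Prop :=
| Segre_tens a b : grA d a -> grB d b -> segre_comp d (tens a b)
| Segre_zero : segre_comp d 0
| Segre_lin c t u : segre_comp d t -> segre_comp d u -> segre_comp d (c *: t + u).

Definition segre (t : tensor A B) : Prop :=
  exists (n : nat) (d : 'I_n -> int) (u : 'I_n -> tensor A B),
    (forall i, segre_comp (d i) (u i)) /\ t = \sum_(i < n) u i.
End Segre.

Section RatFun.
Variables (K : fieldType) (X : finType).

(* K(X), for a finite set X of indeterminates; mpoly indexes its variables by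
   ordinals, hence the enum_rank. *)
Definition ratfun := {fraction {mpoly K[#|X|]}}.
HB.instance Definition _ := GRing.Field.on ratfun.

Definition ratC (c : K) : ratfun := tofrac (c%:MP_[#|X|]).
Definition ratX (i : X) : ratfun := tofrac 'X_(enum_rank i).

Definition ratscale (c : K) (f : ratfun) : ratfun := ratC c * f.

Lemma ratscaleA c d f : ratscale c (ratscale d f) = ratscale (c * d) f.
Proof. by rewrite /ratscale /ratC mpolyCM tofracM mulrA. Qed.
Lemma ratscale1 : left_id 1 ratscale.
Proof. by move=> f; rewrite /ratscale /ratC mpolyC1 tofrac1 mul1r. Qed.
Lemma ratscaleDr : right_distributive ratscale +%R.
Proof. by move=> c f g; rewrite /ratscale mulrDr. Qed.
Lemma ratscaleDl f : {morph ratscale^~ f : c d / c + d}.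
Proof. by move=> c d; rewrite /ratscale /ratC mpolyCD tofracD mulrDl. Qed.
HB.instance Definition _ :=
  GRing.Zmodule_isLmodule.Build K ratfun ratscaleA ratscale1 ratscaleDr ratscaleDl.
Lemma ratscaleAl (c : K) (f g : ratfun) : c *: (f * g) = (c *: f) * g.
Proof. exact: mulrA. Qed.
HB.instance Definition _ := GRing.Lmodule_isLalgebra.Build K ratfun ratscaleAl.
HB.instance Definition _ := GRing.Lalgebra_isComAlgebra.Build K ratfun.
End RatFun.


(* Substitution x_i := h i in a rational function.  It is the expected field
   morphism as soon as the h i are algebraically independent over K, which is
   the only case used below (injective renamings of the variables). *)
Section Subst.
Variables (K : fieldType) (X Y : finType) (h : X -> ratfun K Y).

Definition polysubst (p : {mpoly K[#|X|]}) : ratfun K Y :=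
  mmap (@ratC K Y) (fun i => h (enum_val i)) p.

Definition ratsubst (f : ratfun K X) : ratfun K Y :=
  polysubst \n_(repr f) / polysubst \d_(repr f).
End Subst.

Section Homogeneous.
Variables (K : fieldType) (X : finType) (G : X -> int).

(* Weighted degree, the variable x_i having degree G i. *)
Definition mwt (m : 'X_{1..#|X|}) : int := \sum_(i : X) G i *+ m (enum_rank i).

Definition homog_poly (d : int) (p : {mpoly K[#|X|]}) : Prop :=
  forall m, m \in msupp p -> mwt m = d.

Definition homogeneous (d : int) (f : ratfun K X) : Prop :=
  exists (e : int) (p q : {mpoly K[#|X|]}),
    [/\ q != 0, homog_poly (d + e) p, homog_poly e q & f = tofrac p / tofrac q].

(* The degree of a nonzero homogeneous f (see degreeE); 0 is homogeneous of every
   degree and its value here is irrelevant. *)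
Definition degree (f : ratfun K X) : int :=
  if pselect (exists d, homogeneous d f) is left h then sval (cid h) else 0.
End Homogeneous.

Section HomogeneousTheory.
Variables (K : fieldType) (X : finType) (G : X -> int).

Lemma mwtD m1 m2 : mwt G (m1 + m2)%MM = mwt G m1 + mwt G m2.
Proof.
by rewrite /mwt -big_split; apply: eq_bigr => i _; rewrite mnmDE mulrnDr.
Qed.

Lemma homog_polyD d (p q : {mpoly K[#|X|]}) :
  homog_poly G d p -> homog_poly G d q -> homog_poly G d (p + q).
Proof.
by move=> hp hq m /msuppD_le; rewrite mem_cat => /orP[/hp|/hq].
Qed.

Lemma homog_polyM d e (p q : {mpoly K[#|X|]}) :
  homog_poly G d p -> homog_poly G e q -> homog_poly G (d + e) (p * q).
Proof.
by move=> hp hq m /msuppM_le/allpairsP[[m1 m2] /= [/hp <- /hq <- ->]]; rewrite mwtD.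
Qed.

Lemma homogeneous1 : homogeneous G 0 (1 : ratfun K X).
Proof.
exists 0, 1, 1; split; rewrite ?oner_neq0 ?tofrac1 ?divr1 // => m;
  rewrite msupp1 inE => /eqP->;
  by rewrite /mwt big1 // => i _; rewrite mnm0E mulr0n.
Qed.

Lemma homogeneousX i : homogeneous G (G i) (ratX K i).
Proof.
exists 0, 'X_(enum_rank i), 1; split; rewrite ?oner_neq0 ?tofrac1 ?divr1 // => m.
- rewrite msuppX inE => /eqP->; rewrite addr0 /mwt (bigD1 i) //= big1 => [|j ij].
    by rewrite mnm1E eqxx addr0.
  by rewrite mnm1E (inj_eq enum_rank_inj) eq_sym (negPf ij).
- rewrite msupp1 inE => /eqP->; by rewrite /mwt big1 // => j _; rewrite mnm0E mulr0n.
Qed.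

Lemma homogeneousD d (f g : ratfun K X) :
  homogeneous G d f -> homogeneous G d g -> homogeneous G d (f + g).
Proof.
move=> [e [p [q [q0 hp hq ->]]]] [e' [p' [q' [q'0 hp' hq' ->]]]].
exists (e + e'), (p * q' + p' * q), (q * q'); split.
- by rewrite mulf_neq0.
- apply: homog_polyD; first by rewrite addrA; exact: homog_polyM.
  by rewrite [e + e']addrC addrA; exact: homog_polyM.
- exact: homog_polyM.
- by rewrite tofracD !tofracM addf_div ?tofrac_eq0.
Qed.

Lemma homogeneousM d e (f g : ratfun K X) :
  homogeneous G d f -> homogeneous G e g -> homogeneous G (d + e) (f * g).
Proof.
move=> [a [p [q [q0 hp hq ->]]]] [b [p' [q' [q'0 hp' hq' ->]]]].
exists (a + b), (p * p'), (q * q'); split.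
- by rewrite mulf_neq0.
- by rewrite addrACA; exact: homog_polyM.
- exact: homog_polyM.
- by rewrite !tofracM mulf_div.
Qed.

Lemma homogeneousV d (f : ratfun K X) : homogeneous G d f -> homogeneous G (- d) f^-1.
Proof.
move=> [a [p [q [q0 hp hq ->]]]]; have [->|p0] := eqVneq p 0.
  exists 0, 0, 1; split; rewrite ?oner_neq0 ?tofrac0 ?mul0r ?invr0 // => m.
    by rewrite msupp0.
  by rewrite msupp1 inE => /eqP->; rewrite /mwt big1 // => j _; rewrite mnm0E mulr0n.
by exists (d + a), q, p; split; rewrite ?addKr // invf_div.
Qed.

Lemma homogeneous_exp d (f : ratfun K X) (n : int) :
  homogeneous G d f -> homogeneous G (n * d) (f ^ n).
Proof.
have hX (g : ratfun K X) k e : homogeneous G e g -> homogeneous G (k%:Z * e) (g ^+ k).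
  move=> hg; elim: k => [|k ih]; first by rewrite mul0r expr0; exact: homogeneous1.
  by rewrite exprS -addn1 PoszD mulrDl mul1r addrC; exact: homogeneousM.
move=> hf; case: n => n; first exact: hX.
rewrite NegzE -exprnN -exprVn mulNr -mulrN; exact/hX/homogeneousV.
Qed.

Lemma homogeneous_prod (J : finType) (d : J -> int) (f : J -> ratfun K X) :
  (forall j, homogeneous G (d j) (f j)) ->
  homogeneous G (\sum_j d j) (\prod_j f j).
Proof.
move=> h; elim/big_ind2: _ => //; [exact: homogeneous1|].
by move=> e f1 e' f2; exact: homogeneousM.
Qed.

Lemma homogeneous_uniq d e (f : ratfun K X) :
  f != 0 -> homogeneous G d f -> homogeneous G e f -> d = e.
Proof.
move=> f0 [a [p [q [q0 hp hq fE]]]] [b [p' [q' [q'0 hp' hq' fE']]]].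
have pq0 : p * q' != 0.
  apply: mulf_neq0 => //; apply: contraNneq f0 => p0.
  by rewrite fE p0 tofrac0 mul0r.
have /eqP : tofrac p / tofrac q = tofrac p' / tofrac q' by rewrite -fE -fE'.
rewrite eqr_div ?tofrac_eq0 // -!tofracM tofrac_eq => /eqP E.
have /(_ (mlead (p * q'))) h1 := homog_polyM hp hq'.
have /(_ (mlead (p * q'))) := homog_polyM hp' hq.
rewrite -E => /(_ (mlead_supp pq0)); rewrite (h1 (mlead_supp pq0)).
by rewrite -addrA [e + b + a]addrAC -addrA => /addIr.
Qed.

Lemma degreeE d (f : ratfun K X) :
  f != 0 -> homogeneous G d f -> degree G f = d.
Proof.
move=> f0 hd; rewrite /degree; case: pselect => [h|[]]; last by exists d.
by case: cid => e /= he; exact: (homogeneous_uniq f0 he hd).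
Qed.
End HomogeneousTheory.

(* The initial cluster is indexed by mut + fro (mutable, resp. frozen variables);
   fro_gt0 says that the mutable ones form a proper subset. *)
Record graded_datum := GradedDatum {
  mut : finType;
  fro : finType;
  fro_gt0 : (0 < #|fro|)%N;
  exmat : mut + fro -> mut -> int;
  (* the principal part is skew-symmetric *)
  exmat_skew : forall i j, exmat (inl i) j = - exmat (inl j) i;
  grvec : mut + fro -> int;
  (* B^T G = 0 *)
  grvec_balanced : forall k, \sum_(j : mut + fro) exmat j k * grvec j = 0
}.

Notation idx A := (mut A + fro A)%type.

Definition pospart (b : int) : int := Num.max b 0.
Definition negpart (b : int) : int := Num.max (- b) 0.

Section ClusterAlgebra.
Variables (K : fieldType) (A : graded_datum).

Notation KX := (ratfun K (idx A)).

Record seed := Seed {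
  svar : idx A -> KX;
  smat : idx A -> mut A -> int
}.

Definition init_seed : seed := Seed (@ratX K (idx A)) (@exmat A).

Definition mutate (k : mut A) (s : seed) : seed :=
  Seed
    (fun i => if i == inl k then
       (svar s (inl k))^-1 *
         (\prod_(j : idx A) svar s j ^ pospart (smat s j k)
          + \prod_(j : idx A) svar s j ^ negpart (smat s j k))
     else svar s i)
    (fun i j => if (i == inl k) || (j == k) then - smat s i j
       else smat s i j + pospart (smat s i k) * pospart (smat s (inl k) j)
                       - negpart (smat s i k) * negpart (smat s (inl k) j)).

Inductive reachable : seed -> Prop :=
| Reach_init : reachable init_seed
| Reach_mutate k s : reachable s -> reachable (mutate k s).

Definition seed_cluster (s : seed) : {fset KX} := [fset svar s i | i : idx A]%fset.

Definition is_cluster (S : {fset KX}) : Prop :=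
  exists2 s, reachable s & S = seed_cluster s.

Definition cluster_variable (f : KX) : Prop :=
  exists2 S, is_cluster S & f \in S.

Inductive in_cluster_algebra : KX -> Prop :=
| In_var f : cluster_variable f -> in_cluster_algebra f
| In_frozenV (i : fro A) : in_cluster_algebra (ratX K (inr i : idx A))^-1
| In_const c : in_cluster_algebra c%:A
| In_add f g : in_cluster_algebra f -> in_cluster_algebra g ->
    in_cluster_algebra (f + g)
| In_mul f g : in_cluster_algebra f -> in_cluster_algebra g ->
    in_cluster_algebra (f * g).

Definition cluster_pred : pred KX := fun f => `[< in_cluster_algebra f >].

Record cluster_algebra := ClusterAlgebra {
  ca_val :> KX;
  _ : cluster_pred ca_val
}.
HB.instance Definition _ := [isSub for ca_val].
HB.instance Definition _ := [Choice of cluster_algebra by <:].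

Lemma cluster_pred_closed : subalg_closed cluster_pred.
Proof.
have inM f g : f \in cluster_pred -> g \in cluster_pred -> f * g \in cluster_pred.
  by move=> /asboolP Af /asboolP Ag; apply/asboolP; exact: In_mul.
have inC c : c%:A \in cluster_pred by apply/asboolP; exact: In_const.
split; [by rewrite -[1]scale1r | | exact: inM].
move=> c f g /asboolP Af /asboolP Ag; apply/asboolP; apply: In_add => //.
by rewrite -mulr_algl; apply: In_mul => //; exact: In_const.
Qed.

HB.instance Definition _ := GRing.isSubalgClosed.Build K KX cluster_pred cluster_pred_closed.
HB.instance Definition _ := [SubChoice_isSubComNzRing of cluster_algebra by <:].
HB.instance Definition _ := [SubZmodule_isSubLmodule of cluster_algebra by <:].
HB.instance Definition _ := [SubNzRing_SubLmodule_isSubLalgebra of cluster_algebra by <:].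
HB.instance Definition _ := [SubLalgebra_isSubAlgebra of cluster_algebra by <:].

Lemma reachable_cluster s i : reachable s -> cluster_variable (svar s i).
Proof.
by move=> rs; exists (seed_cluster s); [exists s | apply/imfsetP; exists i].
Qed.

Lemma ratX_cluster_pred (i : idx A) : cluster_pred (ratX K i).
Proof.
apply/asboolP/In_var; exact: (@reachable_cluster init_seed i Reach_init).
Qed.

Definition cvar (i : idx A) : cluster_algebra := ClusterAlgebra (ratX_cluster_pred i).

Lemma frozen_exp_cluster_pred (i : fro A) (d : int) :
  cluster_pred (ratX K (inr i : idx A) ^ d).
Proof.
have inX f n : in_cluster_algebra f -> in_cluster_algebra (f ^+ n).
  move=> Af; elim: n => [|n ih]; last by rewrite exprS; apply: In_mul.
  by rewrite expr0 -[1]scale1r; apply: In_const.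
apply/asboolP; case: d => n; first by apply: inX; apply/asboolP/ratX_cluster_pred.
by rewrite NegzE -exprnN -exprVn; apply/inX/In_frozenV.
Qed.

(* The power x_i ^ d, d : int, of a frozen variable; the algebra has no
   unitRingType structure, so the power is taken in K(x). *)
Definition frozen_exp (i : fro A) (d : int) : cluster_algebra :=
  ClusterAlgebra (frozen_exp_cluster_pred i d).

Definition ca_deg (d : int) (a : cluster_algebra) : Prop :=
  homogeneous (@grvec A) d (ca_val a).

End ClusterAlgebra.

Section ClusterVariables.
Variables (K : fieldType) (A : graded_datum).

Lemma pospartB b : pospart b - negpart b = b.
Proof. by rewrite /pospart /negpart; case: (lerP 0 b) => hb; lia. Qed.

Lemma reachable_homogeneous (s : seed K A) : reachable s ->
  (forall i j, smat s (inl i) j = - smat s (inl j) i) /\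
  exists g : idx A -> int,
    (forall i, homogeneous (@grvec A) (g i) (svar s i)) /\
    (forall k, \sum_i smat s i k * g i = 0).
Proof.
elim=> [|k {}s _ [skew [g [hg bal]]]].
  split; first exact: exmat_skew.
  by exists (@grvec A); split; [exact: homogeneousX | exact: grvec_balanced].
have skk : smat s (inl k) k = 0 by have := skew k k; lia.
pose D := \sum_i pospart (smat s i k) * g i.
have DE : D = \sum_i negpart (smat s i k) * g i.
  apply/eqP; rewrite -subr_eq0 -sumrB -[X in _ == X](bal k); apply/eqP.
  by under eq_bigr do rewrite -mulrBl pospartB.
split=> [i j /=|].
  rewrite !(inj_eq inl_inj) orbC; case: ifP => _; first by rewrite skew.
  by rewrite (skew i j) (skew i k) (skew k j) /pospart /negpart opprK; lia.
exists (fun i => if i == inl k then D - g (inl k) else g i); split=> [i|j] /=.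
  case: eqP => [_|_]; last exact: hg.
  rewrite addrC; apply: homogeneousM; first exact/homogeneousV/hg.
  apply: homogeneousD; last rewrite DE; apply: homogeneous_prod => i'; exact: homogeneous_exp.
case: (eqVneq j k) => [->|jk].
  transitivity (\sum_i - (smat s i k * g i)); last by rewrite sumrN bal oppr0.
  apply: eq_bigr => i _.
  by rewrite orbT mulNr; case: eqP => [->|//]; rewrite skk !mul0r.
have -> : \sum_i (if (i == inl k) || false then - smat s i j
       else smat s i j + pospart (smat s i k) * pospart (smat s (inl k) j)
                       - negpart (smat s i k) * negpart (smat s (inl k) j)) *
      (if i == inl k then D - g (inl k) else g i) =
  \sum_i (smat s i j * g i + pospart (smat s (inl k) j) * (pospart (smat s i k) * g i)
    - negpart (smat s (inl k) j) * (negpart (smat s i k) * g i)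
    + (if i == inl k then - smat s i j * D else 0)).
  apply: eq_bigr => i _; rewrite orbF; case: eqP => [->|_]; last by ring.
  by rewrite skk /pospart /negpart oppr0 Order.POrderTheory.maxxx; ring.
rewrite big_split sumrB big_split /= bal -!mulr_sumr -DE -/D -big_mkcond big_pred1_eq.
have := pospartB (smat s (inl k) j); set P := pospart _; set N := negpart _; move=> <-; ring.
Qed.

Lemma cluster_variable_homogeneous (f : ratfun K (idx A)) :
  cluster_variable f -> exists d, homogeneous (@grvec A) d f.
Proof.
case=> _ [s rs ->] /imfsetP[i _ ->].
by have [_ [g [hg _]]] := reachable_homogeneous rs; exists (g i).
Qed.
End ClusterVariables.

Section Glue.
Variables (A1 A2 : graded_datum) (x : fro A1) (y : fro A2).

Definition glue_mut := (mut A1 + mut A2)%type.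
(* None is the new frozen variable z. *)
Definition glue_fro := option ({f : fro A1 | f != x} + {f : fro A2 | f != y}).

Definition glue_exmat (i : glue_mut + glue_fro) (k : glue_mut) : int :=
  match i, k with
  | inl (inl i1), inl k1 => exmat (inl i1) k1
  | inl (inr i2), inr k2 => exmat (inl i2) k2
  | inr (Some (inl f1)), inl k1 => exmat (inr (val f1)) k1
  | inr (Some (inr f2)), inr k2 => exmat (inr (val f2)) k2
  | inr None, inl k1 => exmat (inr x) k1
  | inr None, inr k2 => exmat (inr y) k2
  | _, _ => 0
  end.

Definition glue_grvec (i : glue_mut + glue_fro) : int :=
  match i with
  | inl (inl i1) => grvec (inl i1)
  | inl (inr i2) => grvec (inl i2)
  | inr (Some (inl f1)) => grvec (inr (val f1))
  | inr (Some (inr f2)) => grvec (inr (val f2))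
  | inr None => grvec (inr x)
  end.

Lemma glue_fro_gt0 : (0 < #|{: glue_fro}|)%N.
Proof. by rewrite card_option. Qed.

Lemma glue_exmat_skew i j : glue_exmat (inl i) j = - glue_exmat (inl j) i.
Proof. by case: i j => [i|i] [j|j] /=; rewrite ?oppr0 // exmat_skew. Qed.

Hypothesis gr_xy : grvec (inr x) = grvec (inr y).

Lemma glue_grvec_balanced k :
  \sum_(j : glue_mut + glue_fro) glue_exmat j k * glue_grvec j = 0.
Proof.
have subS (T : finType) (t : T) (F : T -> int) :
    \sum_(f : {f : T | f != t}) F (val f) = \sum_(f | f != t) F f.
  by rewrite [RHS](reindex_omap (val : {f : T | f != t} -> T) insub) /=;
    [apply: eq_bigl => f; rewrite valK (valP f) eqxx | move=> f ft; rewrite insubT].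
have splitF (T : finType) (t : T) (F : T -> int) :
    F t + \sum_(f : {f : T | f != t}) F (val f) = \sum_f F f.
  by rewrite subS [RHS](bigD1 t).
have sumO (T : finType) (F : option T -> int) :
    \sum_t F t = F None + \sum_t F (Some t).
  rewrite (bigD1 None) //=; congr (_ + _); rewrite (reindex_omap Some id) /=.
    by apply: eq_bigl => t; rewrite eqxx.
  by case.
rewrite big_sumType /= big_sumType /= sumO /= big_sumType /=.
have sum0 (T : finType) (F : T -> int) : \sum_t 0 * F t = 0.
  by rewrite big1 // => t _; rewrite mul0r.
case: k => k; have := grvec_balanced k; rewrite big_sumType /= => bal.
- by rewrite !sum0 !addr0 (splitF _ x (fun f => exmat (inr f) k * grvec (inr f))).
- rewrite !sum0 !add0r gr_xy.
  by rewrite (splitF _ y (fun f => exmat (inr f) k * grvec (inr f))).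
Qed.

Definition glue : graded_datum :=
  GradedDatum glue_fro_gt0 glue_exmat_skew glue_grvec_balanced.

(* The inclusions of the two sets of variables, x and y being sent to z. *)
Definition glue_idx1 (i : idx A1) : idx glue :=
  match i with
  | inl m => inl (inl m)
  | inr f => inr (omap inl (insub f : option {f : fro A1 | f != x}))
  end.

Definition glue_idx2 (i : idx A2) : idx glue :=
  match i with
  | inl m => inl (inr m)
  | inr f => inr (omap inr (insub f : option {f : fro A2 | f != y}))
  end.

Definition glue_z : idx glue := inr None.

Variable K : fieldType.

(* The field embeddings K(x_1), K(x_2) -> K(x_1 box x_2). *)
Definition iota1 : ratfun K (idx A1) -> ratfun K (idx glue) :=
  ratsubst (fun i => ratX K (glue_idx1 i)).
Definition iota2 : ratfun K (idx A2) -> ratfun K (idx glue) :=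
  ratsubst (fun i => ratX K (glue_idx2 i)).

Definition box_cluster (S1 : {fset ratfun K (idx A1)}) (S2 : {fset ratfun K (idx A2)})
    : {fset ratfun K (idx glue)} :=
  ([fset iota1 u | u in S1 `\ ratX K (inr x : idx A1)]
   `|` [fset iota2 v | v in S2 `\ ratX K (inr y : idx A2)]
   `|` [fset ratX K glue_z])%fset.

End Glue.

(* Main.v *)
Require Import Defs.
From HB Require Import structures.
From mathcomp Require Import all_boot all_order all_algebra.
From mathcomp Require Import fraction finmap.
From mathcomp Require Import boolp.
From mathcomp Require Import mpoly ring zify.

Set Implicit Arguments.
Unset Strict Implicit.
Unset Printing Implicit Defensive.

Import Order.TTheory GRing.Theory Num.Theory.
Local Open Scope ring_scope.

(** Both algebras of the theorem are compared inside one field, the field F of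
    rational functions in the disjoint union of the two initial clusters.

    On one side, the two renamings of variables embed A_1 and A_2 in F and
    together give a ring morphism theta : A_1 (x) A_2 -> F.  It is injective
    because rational functions in disjoint sets of variables are linearly
    disjoint over K ([ratfun_linearly_disjoint], [tprod_inj]), which in turn
    comes from the independence of distinct Laurent monomials ([lmon_free]).

    On the other side, the formulas that prescribe phi on the initial cluster
    define a substitution psi of Laurent monomials of F for the variables of the
    glued algebra A.  It is a field embedding, since the exponent vectors of
    these monomials are linearly independent ([psi_exp_inj],
    [alg_indep_lmon]).  As x and y have degree 1, the formulas for x_j and y_j
    specialise to the one for z when j is the glued variable, so that on all
    variables coming from A_1, psi is renaming times y to the power of the
    degree.  Two field morphisms that differ by such a factor on the variables
    differ by t ^ d on every homogeneous element of degree d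
    ([homogeneous_twist]).  Hence psi (iota_1 u) = theta (u (x) y ^ deg u) for
    all homogeneous u, in particular for all cluster variables, and symmetrically
    for A_2.

    Mutation at a variable of A_1 only sees the rows and columns of A_1, because
    the exchange matrix has no entry linking a mutable variable of one side to a
    non-glued variable of the other; so every seed of A restricts to a seed of
    A_1 and to a seed of A_2 ([glue_reachable]), and every seed of A_1 or A_2 is
    such a restriction ([reachable_lift]).  This gives the shape of the clusters
    and shows that psi maps the generators of A into theta of the Segre product
    ([psi_in_segre]).  The isomorphism phi is psi followed by the inverse of
    theta.  It is onto because a (x) b with a and b of degree d is the image of
    iota_1 a * iota_2 b * z ^ (- d) ([theta_comp_psi]), an element of A of degree
    d. *)

(** * Powers in a field *)

Lemma expfz_divD (F : fieldType) (t : F) d e : t != 0 -> t ^ (d + e) / t ^ e = t ^ d.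
Proof. by move=> t0; rewrite expfzDr // mulfK // expfz_neq0. Qed.

Lemma expfz_Mn (F : fieldType) (t : F) (a b : int) n : t != 0 ->
  t ^ (a *+ n + b) = (t ^ a) ^+ n * t ^ b.
Proof. by move=> t0; rewrite expfzDr // exprnP exprz_exp pmulrn mulrzz. Qed.

Lemma mul_twist_cancel (F : fieldType) (a b s t : F) (d : int) : s != 0 -> t != 0 ->
  a * t ^ d * (b * s ^ d) * (s * t) ^ (- d) = a * b.
Proof.
move=> s0 t0; rewrite -invr_expz expfzMl mulrACA [t ^ d * _]mulrC mulfK //.
by rewrite mulf_neq0 ?expfz_neq0.
Qed.

(** * Laurent monomials in rational functions *)

Section Laurent.
Variables (K : fieldType) (Y : finType).

Lemma ratX_neq0 (i : Y) : ratX K i != 0.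
Proof.
rewrite tofrac_eq0; apply/eqP => /(congr1 (mcoeff U_(enum_rank i))) /eqP.
by rewrite mcoeffX eqxx mcoeff0 oner_eq0.
Qed.

Lemma ratscaleE (c : K) (f : ratfun K Y) : c *: f = ratC Y c * f.
Proof. by []. Qed.

Lemma tofracZ (c : K) (p : {mpoly K[#|Y|]}) :
  tofrac (c *: p) = c *: (tofrac p : ratfun K Y).
Proof. by rewrite -mul_mpolyC tofracM. Qed.

Definition lmon (e : Y -> int) : ratfun K Y := \prod_y ratX K y ^ e y.

Lemma lmonD e e' : lmon (fun y => e y + e' y) = lmon e * lmon e'.
Proof.
by rewrite /lmon -big_split; apply: eq_bigr => y _; rewrite expfzDr ?ratX_neq0.
Qed.

Lemma lmon_delta y : lmon (fun y' => (y == y')%:Z) = ratX K y.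
Proof.
rewrite /lmon (bigD1 y) //= eqxx expr1z big1 ?mulr1 // => i.
by rewrite eq_sym => /negPf->; rewrite expr0z.
Qed.

Lemma eq_lmon e e' : e =1 e' -> lmon e = lmon e'.
Proof. by move=> ee; apply: eq_bigr => y _; rewrite ee. Qed.

Lemma lmonX e n : lmon (fun y => n * e y) = lmon e ^ n.
Proof.
rewrite /lmon; elim/big_rec2: _ => [|y a b _ ->]; first by rewrite exp1rz.
by rewrite expfzMl exprz_exp [e y * n]mulrC.
Qed.

(** The absolute values only serve to have a total function: this is the exponent
    vector e when e is nonnegative. *)
Definition mnm_abs (e : Y -> int) : 'X_{1..#|Y|} :=
  [multinom `|e (enum_val j)|%N | j < #|Y|].

Lemma tofrac_mpolyX m :
  tofrac 'X_[m] = \prod_(i : Y) ratX K i ^+ m (enum_rank i) :> ratfun K Y.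
Proof.
rewrite mpolyXE_id rmorph_prod /= (reindex (@enum_rank Y)) /=; last first.
  by apply: onW_bij; exact: enum_rank_bij.
by apply: eq_bigr => i _; rewrite rmorphXn.
Qed.

Lemma lmon_mpolyX e : (forall y, 0 <= e y) -> lmon e = tofrac 'X_[mnm_abs e].
Proof.
move=> e0; rewrite tofrac_mpolyX; apply: eq_bigr => y _.
by rewrite mnmE enum_rankK exprnP gez0_abs.
Qed.

(** A common shift of the exponents, that is, multiplication by one big monomial,
    turns Laurent monomials into monomials of the polynomial ring, where a
    coefficient of the sum can be read off. *)
Lemma lmon_free (I : finType) (c : I -> K) (e : I -> Y -> int) :
  (forall i j, e i =1 e j -> i = j) ->
  \sum_i c i *: lmon (e i) = 0 -> forall i, c i = 0.
Proof.
move=> einj S0 i0.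
(* N bounds all the exponents from below by - N. *)
pose N : int := \sum_i \sum_y `|e i y|.
have leN i y : 0 <= e i y + N.
  have eN : `|e i y| <= N; last by lia.
  rewrite /N (bigD1 i) //= (bigD1 y) //= -addrA lerDl addr_ge0 //.
    by apply: sumr_ge0.
  by apply: sumr_ge0 => j _; apply: sumr_ge0.
have : \sum_i c i *: 'X_[mnm_abs (fun y => e i y + N)] = 0 :> {mpoly K[#|Y|]}.
  apply/eqP; rewrite -(tofrac_eq0 (R := {mpoly K[#|Y|]})) rmorph_sum /=.
  have -> : \sum_i tofrac (c i *: 'X_[mnm_abs (fun y => e i y + N)])
      = (\sum_i c i *: lmon (e i)) * lmon (fun=> N) :> ratfun K Y.
    rewrite mulr_suml; apply: eq_bigr => i _.
    by rewrite tofracZ -lmon_mpolyX // lmonD scalerAl.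
  by rewrite S0 mul0r.
move/(congr1 (mcoeff (mnm_abs (fun y => e i0 y + N)))).
rewrite mcoeff0 raddf_sum /= (bigD1 i0) //= mcoeffZ mcoeffX eqxx mulr1.
rewrite big1 ?addr0 // => i /eqP ne; rewrite mcoeffZ mcoeffX.
case: eqP => [E|]; last by rewrite mulr0.
case: ne; apply: einj => y; apply: (addIr N).
have := congr1 (fun m : 'X_{1..#|Y|} => (m (enum_rank y))%:Z) E.
by rewrite !mnmE !enum_rankK !gez0_abs.
Qed.
End Laurent.

(** * Substitution in rational functions *)

Section Substitution.
Variables (K : fieldType) (X Y : finType).

Lemma ratC_is_zmod_morphism : zmod_morphism (@ratC K Y).
Proof. by move=> c d; rewrite /ratC raddfB /= tofracB. Qed.
Lemma ratC_is_monoid_morphism : monoid_morphism (@ratC K Y).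
Proof. by split=> [|c d]; rewrite /ratC ?mpolyC1 ?tofrac1 // mpolyCM tofracM. Qed.
HB.instance Definition _ :=
  GRing.isZmodMorphism.Build K (ratfun K Y) (@ratC K Y) ratC_is_zmod_morphism.
HB.instance Definition _ :=
  GRing.isMonoidMorphism.Build K (ratfun K Y) (@ratC K Y) ratC_is_monoid_morphism.

(** Algebraic independence of the family h, as injectivity of the evaluation of
    polynomials at h. *)
Definition alg_indep (h : X -> ratfun K Y) :=
  forall p, polysubst h p = 0 -> p = 0.

Lemma ratfun_repr (f : ratfun K X) :
  f = tofrac \n_(repr f) / tofrac \d_(repr f).
Proof.
rewrite -{1}[f]reprK; set x := repr f; unlock FracField.tofrac.
rewrite -[X in _ = _ * X]FracField.pi_inv -[RHS]FracField.pi_mul.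
by rewrite /FracField.invf /FracField.mulf !numden_Ratio ?mul1r ?mulr1 ?oner_neq0
     ?denom_ratioP // Ratio_numden.
Qed.

Lemma ratfunP (f : ratfun K X) :
  exists p q : {mpoly K[#|X|]}, q != 0 /\ f = tofrac p / tofrac q.
Proof.
exists \n_(repr f), \d_(repr f); split; first exact: denom_ratioP.
exact: ratfun_repr.
Qed.

Lemma common_denominator n (f : 'I_n -> ratfun K X) :
  exists q (p : 'I_n -> {mpoly K[#|X|]}),
    q != 0 /\ forall i, f i = tofrac (p i) / tofrac q.
Proof.
have /choice[p pP] : forall i, exists pq : {mpoly K[#|X|]} * {mpoly K[#|X|]},
    pq.2 != 0 /\ f i = tofrac pq.1 / tofrac pq.2.
  by move=> i; have [p [q ?]] := ratfunP (f i); exists (p, q).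
exists (\prod_i (p i).2), (fun i => (p i).1 * \prod_(j | j != i) (p j).2).
have q0 : \prod_i (p i).2 != 0 by apply/prodf_neq0 => i _; case: (pP i).
split=> // i; case: (pP i) => pi0 ->.
apply/eqP; rewrite eqr_div ?tofrac_eq0 // -!tofracM tofrac_eq (bigD1 i) //=.
by apply/eqP; ring.
Qed.

Section Morphism.
Variables (h : X -> ratfun K Y) (hI : alg_indep h).

Lemma polysubst_neq0 p : p != 0 -> polysubst h p != 0.
Proof. by apply: contraNneq => /hI ->. Qed.

(** The definition of [ratsubst] evaluates one chosen representative; for an
    algebraically independent family no denominator vanishes, so any fraction
    gives the same value. *)
Lemma ratsubst_frac p q : q != 0 ->
  ratsubst h (tofrac p / tofrac q) = polysubst h p / polysubst h q.
Proof.
move=> q0; rewrite /ratsubst; set f := tofrac p / tofrac q.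
have d0 : \d_(repr f) != 0 by exact: denom_ratioP.
have /eqP := ratfun_repr f; rewrite {1}/f eqr_div ?tofrac_eq0 // -!tofracM tofrac_eq.
move=> /eqP E; apply/eqP; rewrite eqr_div ?polysubst_neq0 // /polysubst -!rmorphM /=.
by rewrite E mulrC.
Qed.

Lemma ratsubst_is_zmod_morphism : zmod_morphism (ratsubst h).
Proof.
move=> f g; have [p [q [q0 ->]]] := ratfunP f; have [p' [q' [q'0 ->]]] := ratfunP g.
have E : tofrac p / tofrac q - tofrac p' / tofrac q'
    = tofrac (p * q' - p' * q) / tofrac (q * q') :> ratfun K X.
  by rewrite tofracB !tofracM -mulNr addf_div ?tofrac_eq0 // mulNr.
rewrite E !ratsubst_frac ?mulf_neq0 // /polysubst rmorphB !rmorphM /=.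
by rewrite -[in RHS]mulNr addf_div ?mulNr //; exact: polysubst_neq0.
Qed.

Lemma ratsubst_is_monoid_morphism : monoid_morphism (ratsubst h).
Proof.
split=> [|f g].
  have -> : 1 = tofrac 1 / tofrac 1 :> ratfun K X by rewrite tofrac1 divr1.
  by rewrite ratsubst_frac ?oner_neq0 // /polysubst rmorph1 divr1.
have [p [q [q0 ->]]] := ratfunP f; have [p' [q' [q'0 ->]]] := ratfunP g.
rewrite mulf_div -!tofracM !ratsubst_frac ?mulf_neq0 // /polysubst !rmorphM /=.
by rewrite mulf_div.
Qed.

Lemma ratsubst_poly p : ratsubst h (tofrac p) = polysubst h p.
Proof.
rewrite -[tofrac p]divr1 -tofrac1 ratsubst_frac ?oner_neq0 //.
by rewrite /polysubst rmorph1 divr1.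
Qed.

Lemma ratsubst_is_scalable : scalable (ratsubst h).
Proof.
move=> c f; rewrite ratscaleE (ratsubst_is_monoid_morphism).2 ratsubst_poly.
by rewrite /polysubst mmapC.
Qed.

Lemma ratsubstX i : ratsubst h (ratX K i) = h i.
Proof. by rewrite ratsubst_poly /polysubst mmapX mmap1U enum_rankK. Qed.
End Morphism.

(** The monomial with exponents m is sent to the Laurent monomial whose exponent
    at y is the degree of m for the weights e _ y, so [mwt] is what computes the
    linear map on exponents.  When it is injective, a polynomial is sent to a
    combination of distinct Laurent monomials with the same coefficients. *)
Lemma alg_indep_lmon (e : X -> Y -> int) :
  (forall m m', (forall y, mwt (e^~ y) m = mwt (e^~ y) m') -> m = m') ->
  alg_indep (fun i => lmon K (e i)).
Proof.
move=> einj p; rewrite /polysubst (mmapE (msize p)) //.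
have E m : mmap1 (fun i => lmon K (e (enum_val i))) m = lmon K (fun y => mwt (e^~ y) m).
  rewrite /mmap1 /lmon.
  under [LHS]eq_bigr do rewrite -prodrXl; rewrite exchange_big; apply: eq_bigr => y _.
  rewrite (reindex (@enum_rank X)) /=; last by apply/onW_bij/enum_rank_bij.
  rewrite /mwt; elim/big_rec2: _ => [|i a b _ ->]; first by rewrite expr0z.
  by rewrite (expfz_Mn _ _ _ (ratX_neq0 K y)) enum_rankK.
under eq_bigr do rewrite E -ratscaleE; move=> S0.
apply/mpolyP => m; rewrite mcoeff0.
case: (ltnP (mdeg m) (msize p)) => [lt|le]; last first.
  by rewrite memN_msupp_eq0 //; apply: contraL le => /msize_mdeg_lt; rewrite ltnNge.
apply: (lmon_free (c := fun m : 'X_{1..#|X| < msize p} => p@_m) _ S0 (BMultinom lt)).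
by move=> i j ij; apply/val_inj/einj.
Qed.

Lemma alg_indep_ratX (g : X -> Y) :
  injective g -> alg_indep (fun i => ratX K (g i)).
Proof.
move=> ginj.
suff : alg_indep (fun i => lmon K (fun y => (g i == y)%:Z)).
  by congr alg_indep; apply/funext => i; rewrite lmon_delta.
apply: alg_indep_lmon => m m' mm; apply/mnmP => j.
have E n : mwt (fun i => (g i == g (enum_val j))%:Z) n = n j.
  rewrite /mwt (bigD1 (enum_val j)) //= eqxx enum_valK big1 ?addr0 ?natz // => i.
  by rewrite (inj_eq ginj) => /negPf->; rewrite mul0rn.
by have := mm (g (enum_val j)); rewrite !E => -[].
Qed.
End Substitution.

(** * Homogeneous rational functions *)

Section Homogeneity.
Variables (K : fieldType) (X : finType) (G : X -> int).

Lemma homogeneous0 d : homogeneous G d (0 : ratfun K X).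
Proof.
exists 0, 0, 1; split; rewrite ?oner_neq0 ?tofrac0 ?mul0r // => m.
  by rewrite msupp0.
by rewrite msupp1 inE => /eqP->; rewrite /mwt big1 // => j _; rewrite mnm0E mulr0n.
Qed.

Lemma homogeneousC (c : K) : homogeneous G 0 (c%:A : ratfun K X).
Proof.
exists 0, c%:MP, 1; split; first exact: oner_neq0.
- move=> m; rewrite msuppC; case: (c == 0); rewrite // inE => /eqP->.
  by rewrite /mwt big1 // => j _; rewrite mnm0E mulr0n.
- move=> m; rewrite msupp1 inE => /eqP->.
  by rewrite /mwt big1 // => j _; rewrite mnm0E mulr0n.
- by rewrite tofrac1 divr1 ratscaleE mulr1.
Qed.

Lemma homogeneousZ (c : K) d (f : ratfun K X) :
  homogeneous G d f -> homogeneous G d (c *: f).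
Proof.
by move=> hf; rewrite -mulr_algl -[d]add0r; apply: homogeneousM => //; exact: homogeneousC.
Qed.

(** [degree] is a chosen degree, so this holds for f = 0 too, where the degree is
    not determined by f. *)
Lemma homogeneous_degree d (f : ratfun K X) :
  homogeneous G d f -> homogeneous G (degree G f) f.
Proof.
move=> hf; rewrite /degree; case: pselect => [h|[]]; last by exists d.
by case: cid.
Qed.

Lemma homog_poly_prod (I : finType) (P : pred I) (d : I -> int)
    (p : I -> {mpoly K[#|X|]}) :
  (forall i, homog_poly G (d i) (p i)) ->
  homog_poly G (\sum_(i | P i) d i) (\prod_(i | P i) p i).
Proof.
move=> hp; elim/big_ind2: _ => // [|a p1 b p2]; last exact: homog_polyM.
by move=> m; rewrite msupp1 inE => /eqP->; rewrite /mwt big1 // => j _;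
  rewrite mnm0E mulr0n.
Qed.

(** The homogeneous components of a sum of homogeneous elements are well defined:
    over a common homogeneous denominator the numerators are polynomials, and a
    monomial only occurs in the numerators of its own degree. *)
Lemma homogeneous_sum0 (I : finType) (d : I -> int) (f : I -> ratfun K X) e :
  (forall i, homogeneous G (d i) (f i)) -> \sum_i f i = 0 ->
  \sum_(i | d i == e) f i = 0.
Proof.
move=> hf S0.
have /choice[w wP] : forall i, exists w : int * {mpoly K[#|X|]} * {mpoly K[#|X|]},
    [/\ w.2 != 0, homog_poly G (d i + w.1.1) w.1.2, homog_poly G w.1.1 w.2
      & f i = tofrac w.1.2 / tofrac w.2].
  by move=> i; have [a [p [q H]]] := hf i; exists (a, p, q).
pose a i := (w i).1.1; pose q i := (w i).2; pose Q := \prod_i q i.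
pose p i := (w i).1.2 * \prod_(j | j != i) q j.
have Q0 : Q != 0 by apply/prodf_neq0 => i _; case: (wP i).
have fE i : f i = tofrac (p i) / tofrac Q.
  case: (wP i) => q0 _ _ ->.
  apply/eqP; rewrite eqr_div ?tofrac_eq0 // -!tofracM tofrac_eq /Q (bigD1 i) //=.
  by apply/eqP; rewrite /p /q; ring.
have hp i : homog_poly G (d i + \sum_j a j) (p i).
  rewrite (bigD1 i) //= addrA; case: (wP i) => _ h _ _; apply: homog_polyM => //.
  by apply: homog_poly_prod => j; case: (wP j).
have {}S0 : \sum_i p i = 0.
  have /eqP : tofrac (\sum_i p i) / tofrac Q = 0 :> ratfun K X.
    by rewrite rmorph_sum mulr_suml -[RHS]S0; apply: eq_bigr => i _; rewrite fE.
  by rewrite mulf_eq0 invr_eq0 !tofrac_eq0 (negPf Q0) orbF => /eqP.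
under eq_bigr do rewrite fE.
rewrite -mulr_suml -rmorph_sum /=.
suff -> : \sum_(i | d i == e) p i = 0 by rewrite tofrac0 mul0r.
apply/mpolyP => m; rewrite mcoeff0 raddf_sum /=.
have [me|me] := eqVneq (mwt G m) (e + \sum_j a j); last first.
  apply: big1 => i /eqP di; apply: memN_msupp_eq0; apply: contra me => /hp.
  by rewrite di => ->.
transitivity (\sum_i (p i)@_m); last by rewrite -[LHS]raddf_sum S0 raddf0.
rewrite big_mkcond.
apply: eq_bigr => i _; case: eqP => // /eqP di; apply/esym/memN_msupp_eq0.
by apply: contra di => /hp /eqP; rewrite me (inj_eq (addIr _)) eq_sym.
Qed.

(** Apply [homogeneous_sum0] to the family f extended by the opposite of its sum,
    an element of degree e. *)
Lemma homogeneous_component n (d : 'I_n -> int) (f : 'I_n -> ratfun K X) e :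
  (forall i, homogeneous G (d i) (f i)) -> homogeneous G e (\sum_i f i) ->
  \sum_i f i = \sum_(i | d i == e) f i.
Proof.
move=> hf hs.
have sumO (P : pred (option 'I_n)) F : P None ->
    \sum_(i | P i) F i = F None + \sum_(i | P (Some i)) F (Some i) :> ratfun K X.
  move=> PN; rewrite (bigD1 None) //=; congr (_ + _).
  rewrite (reindex_omap Some id) /=; last by case=> // /andP[].
  by apply: eq_bigl => i; rewrite eqxx !andbT.
pose d' i := oapp d e i; pose f' i := oapp f (- \sum_i f i) i.
have hf' i : homogeneous G (d' i) (f' i).
  by case: i => [i|] /=; [exact: hf | rewrite -scaleN1r; exact: homogeneousZ].
have S0 : \sum_i f' i = 0 by rewrite sumO //= addNr.
have := homogeneous_sum0 (d := d') e hf' S0.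
by rewrite sumO //= => /eqP; rewrite addrC subr_eq0 => /eqP.
Qed.

End Homogeneity.

Section HomogeneousMorphism.
Variables (K : fieldType) (X Y : finType).

Lemma lrmorph_poly (f : {lrmorphism ratfun K X -> ratfun K Y}) p :
  f (tofrac p) =
    \sum_(m <- msupp p) p@_m *: \prod_(i : X) f (ratX K i) ^+ m (enum_rank i).
Proof.
rewrite {1}[p]mpolyE !rmorph_sum /=; apply: eq_bigr => m _.
rewrite tofracZ linearZ /= tofrac_mpolyX rmorph_prod.
by congr (_ *: _); apply: eq_bigr => i _; rewrite rmorphXn.
Qed.

(** The substitution x_i := t ^ G i * x_i multiplies each monomial, hence each
    homogeneous polynomial, by t to the power of its degree; numerator and
    denominator of u then contribute t ^ (d + e) / t ^ e. *)
Lemma homogeneous_twist (f g : {lrmorphism ratfun K X -> ratfun K Y})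
    (G : X -> int) (t : ratfun K Y) : t != 0 ->
  (forall i, f (ratX K i) = g (ratX K i) * t ^ G i) ->
  forall d u, homogeneous G d u -> f u = g u * t ^ d.
Proof.
move=> t0 fg d u [e [p [q [q0 hp hq ->]]]].
have twist e' r : homog_poly G e' r -> f (tofrac r) = g (tofrac r) * t ^ e'.
  move=> hr; rewrite !lrmorph_poly mulr_suml; apply: eq_big_seq => m /hr <-.
  rewrite -scalerAl; congr (_ *: _).
  under eq_bigr do rewrite fg exprMn; rewrite big_split /=; congr (_ * _).
  rewrite /mwt; elim/big_rec2: _ => [|i a b _ ->]; first by rewrite expr0z.
  by rewrite expfz_Mn.
rewrite (fmorph_div f) (fmorph_div g) /= (twist _ _ hp) (twist _ _ hq).
rewrite invfM mulrACA; congr (_ * _).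
exact: expfz_divD.
Qed.

Lemma homogeneous_lrmorph (f : {lrmorphism ratfun K X -> ratfun K Y})
    (G : X -> int) (G' : Y -> int) :
  (forall i, homogeneous G' (G i) (f (ratX K i))) ->
  forall d u, homogeneous G d u -> homogeneous G' d (f u).
Proof.
move=> hX d u [e [p [q [q0 hp hq ->]]]].
have hpoly e' r : homog_poly G e' r -> homogeneous G' e' (f (tofrac r)).
  move=> hr; rewrite lrmorph_poly big_seq.
  elim/big_ind: _ => [||m /hr <-]; [exact: homogeneous0|exact: homogeneousD|].
  apply/homogeneousZ/homogeneous_prod => i.
  by rewrite pmulrn mulrzz mulrC exprnP; exact: homogeneous_exp.
rewrite (fmorph_div f) -[d](addrK e).
by apply: homogeneousM; [exact: hpoly | apply/homogeneousV/hpoly].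
Qed.
End HomogeneousMorphism.

(** * Embedding a tensor product of algebras into an algebra *)

Section TensorEmbedding.
Variables (K : fieldType) (A B F : comAlgType K).

Lemma tensor_repr (t : tensor A B) : t = \sum_(p <- repr t) tens p.1 p.2.
Proof.
apply: tensorP => V h bh; rewrite {1}/tlift /formal_eval.
elim: (repr t) => [|p s ih]; first by rewrite !big_nil tlift0.
by rewrite !big_cons ih (tliftD bh) tlift_tens.
Qed.

(** A relation between the a_i with c_k != 0 expresses a_k by the others; moving
    this expression across the bilinear map removes one term of the sum.  It is
    used for the universal map [tens] and for its image in an algebra, so that
    both sums are shortened in the same way. *)
Lemma bilinear_reduce (V : lmodType K) (h : A -> B -> V) (bh : bilinear_map h)
    n (a : 'I_n.+1 -> A) (b : 'I_n.+1 -> B) (c : 'I_n.+1 -> K) k :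
  c k != 0 -> \sum_i c i *: a i = 0 ->
  \sum_i h (a i) (b i) =
    \sum_i h (a (lift k i)) (b (lift k i) - (c (lift k i) / c k) *: b k).
Proof.
move=> ck S0.
have hDr u v w : h u (v - w) = h u v - h u w.
  by have := bh.2 u (-1) w v; rewrite !scaleN1r ![- _ + _]addrC.
have hl (g : {linear A -> V}) : g =1 h^~ (b k) -> 
    h (a k) (b k) = - \sum_i (c (lift k i) / c k) *: h (a (lift k i)) (b k).
  move=> gh; have := congr1 g S0; rewrite linear0 linear_sum /= (bigD1_ord k) //=.
  rewrite linearZ /= gh => /eqP; rewrite addr_eq0 => /eqP E.
  rewrite -[LHS]scale1r -(mulVf ck) -scalerA E scalerN scaler_sumr.
  by congr (- _); apply: eq_bigr => i _; rewrite linearZ /= gh scalerA mulrC.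
rewrite (bigD1_ord k) //= (hl (HB.pack (h^~ (b k))
  (GRing.isLinear.Build _ _ _ _ _ (bh.1 (b k))))) // addrC -sumrB.
by apply: eq_bigr => i _; rewrite hDr (bilinZr bh).
Qed.

Variables (f : {lrmorphism A -> F}) (g : {lrmorphism B -> F}).

Definition tprod : tensor A B -> F := tlift (fun a b => f a * g b).

Lemma tprod_bilinear : bilinear_map (fun a b => f a * g b).
Proof.
split=> [b c a a'|a c b b'] /=.
  by rewrite linearP mulrDl scalerAl.
by rewrite linearP mulrDr scalerAr.
Qed.

Lemma tprod_tens a b : tprod (tens a b) = f a * g b.
Proof. exact: tlift_tens tprod_bilinear _ _. Qed.

Lemma tprod_is_linear : linear tprod.
Proof.
by move=> c t u; rewrite /tprod (tliftD tprod_bilinear) (tliftZ tprod_bilinear).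
Qed.
HB.instance Definition _ :=
  GRing.isLinear.Build K (tensor A B) F *:%R tprod tprod_is_linear.

Lemma tprod_is_monoid_morphism : monoid_morphism tprod.
Proof.
split=> [|t u]; first by rewrite tprod_tens !rmorph1 mulr1.
rewrite /tprod (tliftM tprod_bilinear) /tlift /formal_eval mulr_suml.
apply: eq_bigr => p _; rewrite mulr_sumr; apply: eq_bigr => q _.
by rewrite !rmorphM mulrACA.
Qed.
HB.instance Definition _ :=
  GRing.isMonoidMorphism.Build (tensor A B) F tprod tprod_is_monoid_morphism.

(** The images of A and B are linearly disjoint over K.  The disjunction replaces
    a choice of K-bases: a relation over B between images of elements of A is
    trivial unless these elements are already dependent over K. *)
Definition linearly_disjoint := forall n (a : 'I_n -> A) (b : 'I_n -> B),
  \sum_i f (a i) * g (b i) = 0 ->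
  (forall i, b i = 0) \/ exists2 c : 'I_n -> K, (exists k, c k != 0)
                                              & \sum_i c i *: a i = 0.

(** Induction on the number of pure tensors: as long as the left factors are
    dependent over K a term can be removed, and when they are not linear
    disjointness makes all the right factors vanish. *)
Lemma tprod_inj : linearly_disjoint -> injective tprod.
Proof.
move=> disj; suff ker t : tprod t = 0 -> t = 0.
  by move=> t u /eqP; rewrite -subr_eq0 -raddfB => /eqP/ker/eqP; rewrite subr_eq0 => /eqP.
suff key n (a : 'I_n -> A) (b : 'I_n -> B) :
    \sum_i f (a i) * g (b i) = 0 -> \sum_i tens (a i) (b i) = 0.
  rewrite [t in _ -> t = 0]tensor_repr /tprod /tlift /formal_eval.
  rewrite !(big_nth (0, 0)) !big_mkord.
  exact: (key _ (fun i => (nth (0, 0) (repr t) i).1) (fun i => (nth (0, 0) (repr t) i).2)).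
elim: n a b => [|n ih] a b S0; first by rewrite big_ord0.
have [b0|[c [k ck] ca0]] := disj _ a b S0.
  by apply: big1 => i _; rewrite b0 -(scale0r 0) (bilinZr (@tens_bilinear K A B)) scale0r.
rewrite (bilinear_reduce (@tens_bilinear K A B) _ ck ca0); apply: ih.
by rewrite -(bilinear_reduce tprod_bilinear _ ck ca0).
Qed.
End TensorEmbedding.

(** * Renaming of variables and linear disjointness *)

Section Rename.
Variables (K : fieldType) (X Y : finType) (g : X -> Y).

(** The injectivity proof is an argument so that the morphism structures below can
    be attached to this constant: they rest on [alg_indep_ratX]. *)
Definition rename of injective g := ratsubst (fun i => ratX K (g i)).
Variable ginj : injective g.

HB.instance Definition _ := GRing.isZmodMorphism.Build _ _ (rename ginj)
  (ratsubst_is_zmod_morphism (alg_indep_ratX ginj)).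
HB.instance Definition _ := GRing.isMonoidMorphism.Build _ _ (rename ginj)
  (ratsubst_is_monoid_morphism (alg_indep_ratX ginj)).
HB.instance Definition _ := GRing.isScalable.Build K _ _ *:%R (rename ginj)
  (ratsubst_is_scalable (alg_indep_ratX ginj)).

Lemma renameX i : rename ginj (ratX K i) = ratX K (g i).
Proof. exact: (ratsubstX (alg_indep_ratX ginj)). Qed.

Lemma renameXz i (n : int) : rename ginj (ratX K i ^ n) = ratX K (g i) ^ n.
Proof. by rewrite fmorphXz /= renameX. Qed.

Lemma rename_homogeneous (G : X -> int) (G' : Y -> int) :
  (forall i, G' (g i) = G i) ->
  forall d u, homogeneous G d u -> homogeneous G' d (rename ginj u).
Proof.
move=> gG; apply: homogeneous_lrmorph => i.
by rewrite /= renameX -gG; exact: homogeneousX.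
Qed.
End Rename.

Section Disjoint.
Variables (K : fieldType) (X1 X2 : finType).

Local Notation renameL := (@rename K _ _ inl (@inl_inj X1 X2)).
Local Notation renameR := (@rename K _ _ inr (@inr_inj X1 X2)).

(** The products of a monomial of the left variables by a monomial of the right
    variables are pairwise distinct monomials, hence independent. *)
Lemma coef_rename_mul_eq0 n (p : 'I_n -> {mpoly K[#|X1|]}) (q : 'I_n -> {mpoly K[#|X2|]}) :
  \sum_i renameL (tofrac (p i)) * renameR (tofrac (q i)) = 0 ->
  forall m1 m2, \sum_i (p i)@_m1 * (q i)@_m2 = 0.
Proof.
move=> S0 m1 m2.
(* Bounds on the degrees of all the monomials involved, so that these monomials
   form finite types. *)
pose N1 := (mdeg m1 + \max_i msize (p i)).+1.
pose N2 := (mdeg m2 + \max_i msize (q i)).+1.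
pose e (m : 'X_{1..#|X1| < N1} * 'X_{1..#|X2| < N2}) (i : X1 + X2) : int :=
  match i with inl i => m.1 (enum_rank i) | inr i => m.2 (enum_rank i) end.
have l1 : (mdeg m1 < N1)%N by rewrite ltnS leq_addr.
have l2 : (mdeg m2 < N2)%N by rewrite ltnS leq_addr.
have le1 i : (msize (p i) <= N1)%N.
  by rewrite ltnW // ltnS (leq_trans (leq_bigmax (F := fun i => msize (p i)) i)) ?leq_addl.
have le2 i : (msize (q i) <= N2)%N.
  by rewrite ltnW // ltnS (leq_trans (leq_bigmax (F := fun i => msize (q i)) i)) ?leq_addl.
have einj m m' : e m =1 e m' -> m = m'.
  case: m m' => [a b] [a' b'] E; congr pair; apply/val_inj/mnmP => j.
    by have := E (inl (enum_val j)); rewrite /= enum_valK => -[].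
  by have := E (inr (enum_val j)); rewrite /= enum_valK => -[].
pose c (m : 'X_{1..#|X1| < N1} * 'X_{1..#|X2| < N2}) :=
  \sum_i (p i)@_m.1 * (q i)@_m.2.
suff cS0 : \sum_m c m *: lmon K (e m) = 0.
  exact: (lmon_free einj cS0 (BMultinom l1, BMultinom l2)).
rewrite -[RHS]S0; under eq_bigr do rewrite scaler_suml.
rewrite exchange_big; apply: eq_bigr => i _ /=.
rewrite {2}(mpolywE (le1 i)) {2}(mpolywE (le2 i)) !rmorph_sum /=.
rewrite mulr_suml; under [RHS]eq_bigr do rewrite mulr_sumr.
rewrite pair_big; apply: eq_bigr => -[a b] _ /=.
rewrite !tofracZ !linearZ /= -scalerAl -scalerAr scalerA; congr (_ *: _).
rewrite !tofrac_mpolyX !rmorph_prod /= /lmon big_sumType /=; congr (_ * _);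
  by apply: eq_bigr => k _; rewrite rmorphXn /= renameX.
Qed.

(** After clearing the denominators on both sides, a nonzero right factor has a
    nonzero coefficient at some monomial, and the coefficients of all the right
    factors at this monomial form a dependency between the left factors. *)
Lemma ratfun_linearly_disjoint :
  linearly_disjoint (A := ratfun K X1) (B := ratfun K X2) renameL renameR.
Proof.
move=> n a b S0.
have [D1 [p [D10 aE]]] := common_denominator a.
have [D2 [q [D20 bE]]] := common_denominator b.
have {}S0 : \sum_i renameL (tofrac (p i)) * renameR (tofrac (q i)) = 0.
  have -> : \sum_i renameL (tofrac (p i)) * renameR (tofrac (q i))
      = (\sum_i renameL (a i) * renameR (b i)) * (renameL (tofrac D1) * renameR (tofrac D2)).
    rewrite mulr_suml; apply: eq_bigr => i _.
    have -> : tofrac (p i) = a i * tofrac D1 by rewrite aE divfK ?tofrac_eq0.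
    have -> : tofrac (q i) = b i * tofrac D2 by rewrite bE divfK ?tofrac_eq0.
    by rewrite !rmorphM mulrACA.
  by rewrite S0 mul0r.
have c0 := coef_rename_mul_eq0 S0.
have [b0|/existsNP[k /eqP bk]] := pselect (forall i, b i = 0); [by left | right].
have qk : q k != 0 by apply: contraNneq bk => q0; rewrite bE q0 tofrac0 mul0r.
(* Any monomial of q k would do; the leading one is at hand. *)
exists (fun i => (q i)@_(mlead (q k))); first by exists k; rewrite mleadc_eq0.
have -> : \sum_i (q i)@_(mlead (q k)) *: a i
    = tofrac (\sum_i (q i)@_(mlead (q k)) *: p i) / tofrac D1.
  rewrite rmorph_sum mulr_suml; apply: eq_bigr => i _.
  by rewrite aE /= tofracZ scalerAl.
suff -> : \sum_i (q i)@_(mlead (q k)) *: p i = 0 by rewrite tofrac0 mul0r.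
apply/mpolyP => m; rewrite mcoeff0 raddf_sum -[RHS](c0 m (mlead (q k))).
by apply: eq_bigr => i _; rewrite /= mcoeffZ mulrC.
Qed.
End Disjoint.

(** * Seeds of a glued cluster algebra *)

(** What A inherits from B when the variables of B form part of those of A, in a
    way that the columns of B extended by zero are columns of A.  The inclusions
    of A_1 and A_2 in the glued datum are both of this kind, which allows their
    symmetric roles to be treated once.  The partial inverse [incl_pre] makes
    the extension by zero an [oapp]. *)
Record inclusion (B A : graded_datum) := Inclusion {
  incl_mut : mut B -> mut A;
  incl_fro : fro B -> fro A;
  incl_idx : idx B -> idx A;
  incl_pre : idx A -> option (idx B);
  incl_idx_mut : forall k, incl_idx (inl k) = inl (incl_mut k);
  incl_idx_fro : forall f, incl_idx (inr f) = inr (incl_fro f);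
  incl_idxK : pcancel incl_idx incl_pre;
  incl_preK : ocancel incl_pre incl_idx;
  incl_exmat : forall i k, exmat i (incl_mut k) = oapp (fun i' => exmat i' k) 0 (incl_pre i);
  incl_grvec : forall i, grvec (incl_idx i) = grvec i
}.

Lemma pospart0 : pospart 0 = 0. Proof. by []. Qed.
Lemma negpart0 : negpart 0 = 0. Proof. by []. Qed.

Section Inclusion.
Variables (K : fieldType) (B A : graded_datum) (J : inclusion B A).
Local Notation j := (incl_idx J).
Local Notation jmut := (incl_mut J).
Local Notation pre := (incl_pre J).

Definition incl_map := rename (K := K) (pcan_inj (incl_idxK J)).
HB.instance Definition _ := GRing.LRMorphism.on incl_map.

Lemma incl_mapX i : incl_map (ratX K i) = ratX K (j i).
Proof. by rewrite /incl_map renameX. Qed.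

Lemma incl_mapXz i (n : int) : incl_map (ratX K i ^ n) = ratX K (j i) ^ n.
Proof. by rewrite /incl_map renameXz. Qed.

Lemma incl_map_homogeneous d u :
  homogeneous (@grvec B) d u -> homogeneous (@grvec A) d (incl_map u).
Proof. exact: rename_homogeneous (incl_grvec J) d u. Qed.

(** The seed t is what is left of s when only the variables of B are kept; in
    particular the columns of s at these variables are those of t extended by
    zero. *)
Definition restricts (s : seed K A) (t : seed K B) :=
  (forall i, svar s (j i) = incl_map (svar t i)) /\
  (forall i k, smat s i (jmut k) = oapp (smat t ^~ k) 0 (pre i)).

Lemma restricts_init : restricts (init_seed K A) (init_seed K B).
Proof. by split=> [i|i k] /=; [rewrite incl_mapX | exact: incl_exmat]. Qed.

Lemma prod_incl (x : idx A -> ratfun K (idx A)) (e : idx B -> int) :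
  \prod_i x i ^ oapp e 0 (pre i) = \prod_i x (j i) ^ e i.
Proof.
transitivity (\prod_(i | pre i) x i ^ oapp e 0 (pre i)).
  by rewrite [RHS]big_mkcond; apply: eq_bigr => i _; case: (pre i) => //=; rewrite expr0z.
rewrite (reindex_omap j pre) => [|i].
  by apply: eq_big => i; rewrite incl_idxK ?eqxx.
by have := incl_preK J i; case: (pre i) => //= i' ->.
Qed.

Lemma eq_incl_mut i k : (j i == inl (jmut k)) = (i == inl k).
Proof. by rewrite -(incl_idx_mut J) (inj_eq (pcan_inj (incl_idxK J))). Qed.

Lemma incl_mut_inj : injective jmut.
Proof.
move=> k k' E; have : j (inl k) = j (inl k') by rewrite !incl_idx_mut E.
by move/(pcan_inj (incl_idxK J)) => [].
Qed.

(** By the zeros in column k, the exchange relation of s at k only involves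
    variables of B, where it is the image of the exchange relation of t, and
    the rows outside B do not move. *)
Lemma restricts_mutate k s t :
  restricts s t -> restricts (mutate (jmut k) s) (mutate k t).
Proof.
move=> [sv sm].
have prodE (F : int -> int) : F 0 = 0 ->
    \prod_i svar s i ^ F (smat s i (jmut k))
      = incl_map (\prod_i svar t i ^ F (smat t i k)).
  move=> F0; rewrite rmorph_prod /=.
  transitivity (\prod_i svar s i ^ oapp (fun i' => F (smat t i' k)) 0 (pre i)).
    by apply: eq_bigr => i _; rewrite sm; case: (pre i) => [//|] /=; rewrite F0.
  by rewrite prod_incl; apply: eq_bigr => i _; rewrite sv fmorphXz.
split=> [i|i k'] /=.
  rewrite eq_incl_mut; case: eqP => // _.
  by rewrite rmorphM fmorphV rmorphD !prodE //= -incl_idx_mut sv.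
rewrite (inj_eq incl_mut_inj) !sm -incl_idx_mut incl_idxK /=.
have := incl_preK J i; case E: (pre i) => [i'|] /= => [<-|_].
  by rewrite (inj_eq (pcan_inj (incl_idxK J))).
by case: ifP => _; rewrite ?oppr0 // pospart0 negpart0 !mul0r addr0 subr0.
Qed.

(** The columns of s at variables of B are zero in row k, so that mutating at k
    adds nothing to them. *)
Lemma restricts_mutate_out k s t :
  pre (inl k) = None -> restricts s t -> restricts (mutate k s) t.
Proof.
move=> k0 [sv sm]; split=> [i|i k'] /=.
  rewrite -sv; case: eqP => // ji; move: k0; rewrite -ji incl_idxK //.
have /negPf-> : jmut k' != k.
  by apply: contra_eqN k0 => /eqP<-; rewrite -incl_idx_mut incl_idxK.
rewrite orbF !sm k0 /= pospart0 negpart0 !mulr0 addr0 subr0.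
by case: eqP => // ->; rewrite k0 /= oppr0.
Qed.

Lemma reachable_lift t : reachable t -> exists2 s, reachable s & restricts s t.
Proof.
elim=> [|k {}t _ [s rs st]].
  by exists (init_seed K A); [exact: Reach_init | exact: restricts_init].
by exists (mutate (jmut k) s); [exact: Reach_mutate | exact: restricts_mutate].
Qed.

Lemma incl_map_algebra f : in_cluster_algebra f -> in_cluster_algebra (incl_map f).
Proof.
elim=> {f} [_ [_ [t rt ->] /imfsetP[i _ ->]]|i|c|f g _ Af _ Ag|f g _ Af _ Ag].
- have [s rs [sv _]] := reachable_lift rt.
  by rewrite -sv; apply/In_var/reachable_cluster.
- by rewrite fmorphV /= incl_mapX incl_idx_fro; exact: In_frozenV.
- by rewrite linearZ rmorph1; exact: In_const.
- by rewrite rmorphD; exact: In_add.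
- by rewrite rmorphM; exact: In_mul.
Qed.

Lemma incl_map_pred f : cluster_pred f -> cluster_pred (incl_map f).
Proof. by move=> /asboolP hf; apply/asboolP; exact: incl_map_algebra. Qed.
End Inclusion.

Lemma reachable_frozen (K : fieldType) (A : graded_datum) (s : seed K A) f :
  reachable s -> svar s (inr f) = ratX K (inr f).
Proof. by elim=> //= k {}s _ ->. Qed.

Section GlueInclusions.
Variables (A1 A2 : graded_datum) (x : fro A1) (y : fro A2).
Hypothesis gr_xy : grvec (inr x) = grvec (inr y).
Local Notation A := (glue gr_xy).

Definition glue_pre1 (i : idx A) : option (idx A1) :=
  match i with
  | inl (inl m) => Some (inl m)
  | inr (Some (inl f)) => Some (inr (val f))
  | inr None => Some (inr x)
  | _ => None
  end.

Definition glue_pre2 (i : idx A) : option (idx A2) :=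
  match i with
  | inl (inr m) => Some (inl m)
  | inr (Some (inr f)) => Some (inr (val f))
  | inr None => Some (inr y)
  | _ => None
  end.

Lemma glue_idx1K : pcancel (glue_idx1 gr_xy) glue_pre1.
Proof. by case=> [m|f] //=; case: insubP => [u _ /= <-|/negPn/eqP->]. Qed.

Lemma glue_idx2K : pcancel (glue_idx2 gr_xy) glue_pre2.
Proof. by case=> [m|f] //=; case: insubP => [u _ /= <-|/negPn/eqP->]. Qed.

Lemma glue_pre1K : ocancel glue_pre1 (glue_idx1 gr_xy).
Proof. by case=> [[m|m]|[[f|f]|]] //=; rewrite ?valK // insubN ?eqxx. Qed.

Lemma glue_pre2K : ocancel glue_pre2 (glue_idx2 gr_xy).
Proof. by case=> [[m|m]|[[f|f]|]] //=; rewrite ?valK // insubN ?eqxx. Qed.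

Definition glue_incl1 : inclusion A1 A.
Proof.
apply: (@Inclusion A1 A inl (fun f => omap inl (insub f)) _ _ _ _ glue_idx1K glue_pre1K) => //.
- by move=> [[m|m]|[[f|f]|]] k.
- by case=> [m|f] //=; case: insubP => [u _ /= <-|/negPn/eqP->].
Defined.

Definition glue_incl2 : inclusion A2 A.
Proof.
apply: (@Inclusion A2 A inr (fun f => omap inr (insub f)) _ _ _ _ glue_idx2K glue_pre2K) => //.
- by move=> [[m|m]|[[f|f]|]] k.
- by case=> [m|f] //=; case: insubP => [u _ /= <-|/negPn/eqP->].
Defined.

Variable K : fieldType.

Lemma iota1E : iota1 gr_xy (K := K) = incl_map (K := K) glue_incl1. Proof. by []. Qed.
Lemma iota2E : iota2 gr_xy (K := K) = incl_map (K := K) glue_incl2. Proof. by []. Qed.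

(** A mutable variable of the glued datum comes from exactly one side: the
    mutation happens inside this side and outside the other. *)
Lemma glue_reachable (s : seed K A) : reachable s ->
  exists t1 t2, [/\ reachable t1, reachable t2,
    restricts glue_incl1 s t1 & restricts glue_incl2 s t2].
Proof.
elim=> [|k {}s _ [t1 [t2 [r1 r2 st1 st2]]]].
  exists (init_seed K A1), (init_seed K A2).
  by split; try exact: Reach_init; exact: restricts_init.
case: k => k.
- exists (mutate k t1), t2; split=> //; first exact: Reach_mutate.
    exact: (restricts_mutate k st1).
  exact: restricts_mutate_out.
- exists t1, (mutate k t2); split=> //; first exact: Reach_mutate.
    exact: restricts_mutate_out.
  exact: (restricts_mutate k st2).
Qed.

Lemma glue_cases (i : idx A) :
  [\/ exists2 i1, i1 != inr x & i = glue_idx1 gr_xy i1,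
      exists2 i2, i2 != inr y & i = glue_idx2 gr_xy i2 | i = glue_z gr_xy].
Proof.
case: i => [[m|m]|[[f|f]|]].
- by constructor 1; exists (inl m).
- by constructor 2; exists (inl m).
- by constructor 1; exists (inr (val f)); rewrite /= ?valK // (inj_eq inr_inj) (valP f).
- by constructor 2; exists (inr (val f)); rewrite /= ?valK // (inj_eq inr_inj) (valP f).
- by constructor 3.
Qed.

Lemma glue_idx1_x : glue_idx1 gr_xy (inr x) = glue_z gr_xy.
Proof. by rewrite /= insubN ?eqxx. Qed.
Lemma glue_idx2_y : glue_idx2 gr_xy (inr y) = glue_z gr_xy.
Proof. by rewrite /= insubN ?eqxx. Qed.

Lemma in_box_clusterP (S1 : {fset ratfun K (idx A1)}) (S2 : {fset ratfun K (idx A2)}) f :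
  reflect [\/ exists2 u, u != ratX K (inr x) /\ u \in S1 & f = iota1 gr_xy u,
              exists2 v, v != ratX K (inr y) /\ v \in S2 & f = iota2 gr_xy v
            | f = ratX K (glue_z gr_xy)]
          (f \in box_cluster gr_xy S1 S2).
Proof.
apply: (iffP idP) => [/fsetUP[/fsetUP[|]|]|[]].
- case/imfsetP => u /= /fsetD1P[ux uS] ->.
  by constructor 1; exists u.
- case/imfsetP => v /= /fsetD1P[vy vS] ->.
  by constructor 2; exists v.
- by move/fset1P => ->; constructor 3.
- case=> u [ux uS] ->; apply/fsetUP; left; apply/fsetUP; left.
  by apply/imfsetP; exists u => //=; apply/fsetD1P.
- case=> v [vy vS] ->; apply/fsetUP; left; apply/fsetUP; right.
  by apply/imfsetP; exists v => //=; apply/fsetD1P.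
- by move=> ->; apply/fsetUP; right; apply/fset1P.
Qed.

(** The variables of a seed of A are the images of those of its two restrictions.
    Nothing is lost when x and y are discarded from the latter, since both are
    sent to z, which is put back. *)
Lemma glue_cluster_box (S : {fset ratfun K (idx A)}) : is_cluster S ->
  exists S1 S2, [/\ is_cluster S1, is_cluster S2 & S = box_cluster gr_xy S1 S2].
Proof.
case=> s rs ->; have [t1 [t2 [r1 r2 [sv1 _] [sv2 _]]]] := glue_reachable rs.
exists (seed_cluster t1), (seed_cluster t2); split; [by exists t1|by exists t2|].
have sz : svar s (glue_z gr_xy) = ratX K (glue_z gr_xy) by exact: reachable_frozen.
apply/fsetP => f; apply/imfsetP/in_box_clusterP => [[i _ ->]|].
  have [[i1 _ ->]|[i2 _ ->]|->] := glue_cases i; last by constructor 3.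
    have [tx|tx] := eqVneq (svar t1 i1) (ratX K (inr x)).
      by constructor 3; rewrite (sv1 i1) tx incl_mapX -glue_idx1_x.
    constructor 1; exists (svar t1 i1); last exact: (sv1 i1).
    by split; [exact: tx | apply/imfsetP; exists i1].
  have [ty|ty] := eqVneq (svar t2 i2) (ratX K (inr y)).
    by constructor 3; rewrite (sv2 i2) ty incl_mapX -glue_idx2_y.
  constructor 2; exists (svar t2 i2); last exact: (sv2 i2).
  by split; [exact: ty | apply/imfsetP; exists i2].
case=> [[_ [_ /imfsetP[i _ ->]] ->]|[_ [_ /imfsetP[i _ ->]] ->]|->].
- by exists (glue_idx1 gr_xy i); last rewrite (sv1 i).
- by exists (glue_idx2 gr_xy i); last rewrite (sv2 i).
- by exists (glue_z gr_xy).
Qed.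
End GlueInclusions.

(** * Closure properties of the Segre product *)

Section SegreClosure.
Variables (K : fieldType) (A B : comAlgType K).
Variables (grA : int -> A -> Prop) (grB : int -> B -> Prop).

Lemma segre_of_comp d t : segre_comp grA grB d t -> segre grA grB t.
Proof.
move=> ht; exists 1, (fun=> d), (fun=> t); split=> //.
by rewrite big_ord1.
Qed.

Lemma segreD t u : segre grA grB t -> segre grA grB u -> segre grA grB (t + u).
Proof.
move=> [n [d [f [hf ->]]]] [n' [d' [f' [hf' ->]]]].
exists (n + n')%N, (fun i => match split i with inl j => d j | inr j => d' j end),
  (fun i => match split i with inl j => f j | inr j => f' j end).
split=> [i|]; first by case: split.
rewrite big_split_ord /=; congr (_ + _); apply: eq_bigr => i _.
  by rewrite -/(unsplit (inl i)) unsplitK.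
by rewrite -/(unsplit (inr i)) unsplitK.
Qed.

Lemma segre_sum n (f : 'I_n -> tensor A B) :
  (forall i, segre grA grB (f i)) -> segre grA grB (\sum_i f i).
Proof.
move=> hf; elim/big_ind: _ => //; last exact: segreD.
exact/(@segre_of_comp 0)/Segre_zero.
Qed.

Lemma segre_comp_sum d (I : finType) (P : pred I) (f : I -> tensor A B) :
  (forall i, P i -> segre_comp grA grB d (f i)) ->
  segre_comp grA grB d (\sum_(i | P i) f i).
Proof.
move=> hf; elim/big_ind: _ => //; first exact: Segre_zero.
by move=> t u ht hu; rewrite -[t]scale1r; exact: Segre_lin.
Qed.

Hypothesis grAM : forall d e a a', grA d a -> grA e a' -> grA (d + e) (a * a').
Hypothesis grBM : forall d e b b', grB d b -> grB e b' -> grB (d + e) (b * b').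

Lemma segre_compM d e t u : segre_comp grA grB d t -> segre_comp grA grB e u ->
  segre_comp grA grB (d + e) (t * u).
Proof.
move=> ht hu; elim: ht => [a b ha hb||c t1 t2 _ h1 _ h2]; last first.
- by rewrite mulrDl -tscalerAl; exact: Segre_lin.
- by rewrite mul0r; exact: Segre_zero.
elim: hu => [a' b' ha' hb'||c u1 u2 _ h1 _ h2].
- by rewrite tensM; apply: Segre_tens; [exact: grAM | exact: grBM].
- by rewrite mulr0; exact: Segre_zero.
- by rewrite mulrC mulrDl -tscalerAl ![_ * tens a b]mulrC; exact: Segre_lin.
Qed.

Lemma segreM t u : segre grA grB t -> segre grA grB u -> segre grA grB (t * u).
Proof.
move=> [n [d [f [hf ->]]]] [n' [d' [f' [hf' ->]]]].
rewrite mulr_suml; apply: segre_sum => i; rewrite mulr_sumr; apply: segre_sum => i'.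
exact: segre_of_comp (segre_compM (hf i) (hf' i')).
Qed.
End SegreClosure.

(** * The isomorphism between the glued algebra and the Segre product *)

Section ClusterAlgebraMap.
Variables (K : fieldType) (A : graded_datum) (Y : finType).
Variable f : {lrmorphism ratfun K (idx A) -> ratfun K Y}.

Definition ca_map (a : cluster_algebra K A) : ratfun K Y := f (val a).

Lemma ca_map_is_linear : linear ca_map.
Proof. by move=> c a a'; rewrite /ca_map !linearP. Qed.
Lemma ca_map_is_monoid_morphism : monoid_morphism ca_map.
Proof. by split=> [|a a']; rewrite /ca_map ?rmorph1 // !rmorphM. Qed.
HB.instance Definition _ := GRing.isLinear.Build K _ _ *:%R ca_map ca_map_is_linear.
HB.instance Definition _ :=
  GRing.isMonoidMorphism.Build _ _ ca_map ca_map_is_monoid_morphism.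
End ClusterAlgebraMap.

Section GlueEmbedding.
Variables (K : fieldType) (A1 A2 : graded_datum) (x : fro A1) (y : fro A2).
Hypothesis gr_xy : grvec (inr x) = grvec (inr y).
Hypotheses (deg_x : grvec (inr x) = 1) (deg_y : grvec (inr y) = 1).
Local Notation A := (glue gr_xy).
Local Notation C1 := (cluster_algebra K A1).
Local Notation C2 := (cluster_algebra K A2).
Local Notation C := (cluster_algebra K A).
Local Notation comp := (segre_comp (@ca_deg K A1) (@ca_deg K A2)).
Local Notation segre := (segre (@ca_deg K A1) (@ca_deg K A2)).
Local Notation X12 := (idx A1 + idx A2)%type.
Local Notation renL := (@rename K _ X12 inl (@inl_inj (idx A1) (idx A2))).
Local Notation renR := (@rename K _ X12 inr (@inr_inj (idx A1) (idx A2))).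
Local Notation xL := (ratX K (inl (inr x) : X12)).
Local Notation yR := (ratX K (inr (inr y) : X12)).

(** Exponent of the variable r in psi of the variable i.  The shared variable z
    falls under the first case with i1 = x; its exponent at y is then the degree
    of x, which is 1 in the situation of the theorem. *)
Definition psi_exp (i : idx A) (r : X12) : int :=
  match glue_pre1 i, glue_pre2 i, r with
  | Some i1, _, inl j => (i1 == j)%:Z
  | Some i1, _, inr j => grvec i1 * (inr y == j)%:Z
  | None, Some i2, inl j => grvec i2 * (inr x == j)%:Z
  | None, Some i2, inr j => (i2 == j)%:Z
  | None, None, _ => 0
  end.

(** Every variable i other than z has a private coordinate, at which psi i'
    has exponent 1 if i' = i and 0 otherwise.  This determines all the exponents
    of a monomial but the one of z, and then the coordinate x, where z
    contributes 1, determines this one. *)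
Lemma psi_exp_inj m m' :
  (forall r, mwt (psi_exp^~ r) m = mwt (psi_exp^~ r) m') -> m = m'.
Proof.
move=> E; pose z := glue_z gr_xy.
have fne (B : graded_datum) (t : fro B) (f : {f : fro B | f != t}) :
    (inr t == inr (val f) :> idx B) = false.
  by rewrite (inj_eq inr_inj) eq_sym; apply/negbTE/(valP f).
have sep i : i != z -> exists r, forall i', psi_exp i' r = (i' == i)%:Z.
  case: i => [[k|k]|[[f|f]|]] // _.
  - exists (inl (inl k)) => -[[k'|k']|[[f'|f']|]] //=; by rewrite /psi_exp /= mulr0.
  - exists (inr (inl k)) => -[[k'|k']|[[f'|f']|]] //=; by rewrite /psi_exp /= mulr0.
  - exists (inl (inr (val f))) => -[[k'|k']|[[f'|f']|]] //=;
      by rewrite /psi_exp /= fne ?mulr0.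
  - exists (inr (inr (val f))) => -[[k'|k']|[[f'|f']|]] //=;
      by rewrite /psi_exp /= fne ?mulr0.
have mE i : i != z -> m (enum_rank i) = m' (enum_rank i).
  case/sep => r rE; have := E r; rewrite /mwt.
  have sumE n : \sum_i' psi_exp i' r *+ n (enum_rank i') = (n (enum_rank i))%:Z.
    rewrite (bigD1 i) //= rE eqxx natz big1 ?addr0 // => i' /negPf ii'.
    by rewrite rE ii' mul0rn.
  by rewrite !sumE => -[].
apply/mnmP => k; rewrite -[k]enum_valK; have [->|/mE //] := eqVneq (enum_val k) z.
have := E (inl (inr x)); rewrite /mwt !(bigD1 (P := xpredT) z) //=.
rewrite (eq_bigr (fun i => psi_exp i (inl (inr x)) *+ m' (enum_rank i))); last first.
  by move=> i /mE ->.
by move/addIr; rewrite /psi_exp /= eqxx !natz => -[].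
Qed.

Definition psi := ratsubst (fun i => lmon K (psi_exp i)).

HB.instance Definition _ := GRing.isZmodMorphism.Build _ _ psi
  (ratsubst_is_zmod_morphism (alg_indep_lmon psi_exp_inj)).
HB.instance Definition _ := GRing.isMonoidMorphism.Build _ _ psi
  (ratsubst_is_monoid_morphism (alg_indep_lmon psi_exp_inj)).
HB.instance Definition _ := GRing.isScalable.Build K _ _ *:%R psi
  (ratsubst_is_scalable (alg_indep_lmon psi_exp_inj)).

Lemma psiX i : psi (ratX K i) = lmon K (psi_exp i).
Proof. exact: (ratsubstX (alg_indep_lmon psi_exp_inj)). Qed.

Lemma psi_inj : injective psi.
Proof. by move=> f g; exact: (fmorph_inj psi). Qed.

Lemma psiM f g : psi (f * g) = psi f * psi g.
Proof. by rewrite rmorphM. Qed.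

Lemma psi_sum (I : finType) (P : pred I) (f : I -> ratfun K (idx A)) :
  psi (\sum_(i | P i) f i) = \sum_(i | P i) psi (f i).
Proof. by rewrite raddf_sum. Qed.

Lemma psi_MMXz f g i (n : int) :
  psi (f * g * ratX K i ^ n) = psi f * psi g * psi (ratX K i) ^ n.
Proof. by rewrite !rmorphM /= fmorphXz. Qed.

Lemma psi_idx1 i : psi (ratX K (glue_idx1 gr_xy i)) = renL (ratX K i) * yR ^ grvec i.
Proof.
rewrite psiX renameX -lmon_delta -(lmon_delta K (inr (inr y) : X12)) -lmonX -lmonD.
apply: eq_lmon => r; rewrite /psi_exp glue_idx1K.
by case: r => j /=; rewrite ?mulr0 ?addr0 ?add0r.
Qed.

(** For i = y the variable is z, whose image was chosen from the side of A_1;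
    both descriptions agree because x and y have degree 1. *)
Lemma psi_idx2 i : psi (ratX K (glue_idx2 gr_xy i)) = renR (ratX K i) * xL ^ grvec i.
Proof.
have [->|iy] := eqVneq i (inr y).
  rewrite glue_idx2_y -(glue_idx1_x gr_xy) psi_idx1 !renameX -gr_xy deg_x !expr1z.
  exact: mulrC.
rewrite psiX renameX -lmon_delta -(lmon_delta K (inl (inr x) : X12)) -lmonX -lmonD.
apply: eq_lmon => r; rewrite /psi_exp.
have -> : glue_pre1 (glue_idx2 gr_xy i) = None.
  by case: i iy => [k|f] //= fy; rewrite insubT ?(inj_eq inr_inj).
rewrite glue_idx2K.
by case: r => j /=; rewrite ?mulr0 ?addr0 ?add0r.
Qed.

Lemma psi_iota1 d u : homogeneous (@grvec A1) d u ->
  psi (iota1 gr_xy u) = renL u * yR ^ d.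
Proof.
pose f : {lrmorphism _ -> _} := psi \o incl_map (K := K) (glue_incl1 gr_xy).
apply: (homogeneous_twist (f := f) (g := renL)); first exact: ratX_neq0.
by move=> i; rewrite /f /= incl_mapX; exact: psi_idx1.
Qed.

Lemma psi_iota2 d u : homogeneous (@grvec A2) d u ->
  psi (iota2 gr_xy u) = renR u * xL ^ d.
Proof.
pose f : {lrmorphism _ -> _} := psi \o incl_map (K := K) (glue_incl2 gr_xy).
apply: (homogeneous_twist (f := f) (g := renR)); first exact: ratX_neq0.
by move=> i; rewrite /f /= incl_mapX; exact: psi_idx2.
Qed.

Local Notation embL := (ca_map renL).
Local Notation embR := (ca_map renR).
Local Notation theta := (tprod embL embR).

Lemma theta_tens a b : theta (tens a b) = renL (val a) * renR (val b).
Proof. exact: (tprod_tens embL embR). Qed.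

Lemma theta_inj : injective theta.
Proof.
apply: tprod_inj => n a b S0.
have [b0|[c ck ca]] :=
  ratfun_linearly_disjoint (a := fun i => val (a i)) (b := fun i => val (b i)) S0.
  by left=> i; apply: val_inj; rewrite b0 raddf0.
right; exists c => //; apply: val_inj.
by rewrite raddf_sum raddf0 -[RHS]ca; apply: eq_bigr => i _; exact: linearZ_LR.
Qed.

Lemma ca_degM (B : graded_datum) d e (a b : cluster_algebra K B) :
  ca_deg d a -> ca_deg e b -> ca_deg (d + e) (a * b).
Proof. exact: homogeneousM. Qed.

Lemma frozen_exp_deg (B : graded_datum) (f : fro B) d :
  grvec (inr f) = 1 -> ca_deg d (frozen_exp K f d).
Proof.
by move=> f1; rewrite -[d in ca_deg d _]mulr1 -f1; apply/homogeneous_exp/homogeneousX.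
Qed.

Lemma theta_iota1 d (a : C1) : ca_deg d a ->
  comp d (tens a (frozen_exp K y d)) /\
  theta (tens a (frozen_exp K y d)) = psi (iota1 gr_xy (val a)).
Proof.
move=> ha; split; first by apply: Segre_tens => //; exact: frozen_exp_deg.
by rewrite theta_tens (psi_iota1 ha) /= renameXz.
Qed.

Lemma theta_iota2 d (b : C2) : ca_deg d b ->
  comp d (tens (frozen_exp K x d) b) /\
  theta (tens (frozen_exp K x d) b) = psi (iota2 gr_xy (val b)).
Proof.
move=> hb; split; first by apply: Segre_tens => //; exact: frozen_exp_deg.
by rewrite theta_tens (psi_iota2 hb) /= renameXz [LHS]mulrC.
Qed.

Lemma theta_z : theta (tens (cvar K (inr x)) (cvar K (inr y))) = psi (ratX K (glue_z gr_xy)).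
Proof.
by rewrite theta_tens -(glue_idx1_x gr_xy) psi_idx1 /= deg_x expr1z [in RHS]renameX !renameX.
Qed.

Lemma psi_z : psi (ratX K (glue_z gr_xy)) = xL * yR.
Proof. by rewrite -theta_z theta_tens /= !renameX. Qed.

(** Each generator of the glued algebra is iota_1 or iota_2 of a homogeneous
    element, namely a cluster variable or the inverse of a frozen variable, so
    that [theta_iota1] or [theta_iota2] applies to it. *)
Lemma psi_in_segre f : in_cluster_algebra (A := A) f ->
  exists2 t, segre t & theta t = psi f.
Proof.
have from1 (a : C1) d : ca_deg d a -> exists2 t,
    segre t & theta t = psi (iota1 gr_xy (val a)).
  by case/theta_iota1 => /segre_of_comp; exists (tens a (frozen_exp K y d)).
have from2 (b : C2) d : ca_deg d b -> exists2 t,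
    segre t & theta t = psi (iota2 gr_xy (val b)).
  by case/theta_iota2 => /segre_of_comp; exists (tens (frozen_exp K x d) b).
elim=> {f} [_ [_ [s rs ->] /imfsetP[i _ ->]]|i|c
  |f g _ [t ht tE] _ [u hu uE]|f g _ [t ht tE] _ [u hu uE]].
- have [t1 [t2 [r1 r2 [sv1 _] [sv2 _]]]] := glue_reachable rs.
  have lift1 i1 : exists2 t, segre t
      & theta t = psi (svar s (glue_idx1 gr_xy i1)).
    have cv := reachable_cluster i1 r1; have [d hd] := cluster_variable_homogeneous cv.
    have Pa : cluster_pred (svar t1 i1) by apply/asboolP/In_var.
    by rewrite (sv1 i1); exact: (from1 (ClusterAlgebra Pa) d).
  have lift2 i2 : exists2 t, segre t
      & theta t = psi (svar s (glue_idx2 gr_xy i2)).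
    have cv := reachable_cluster i2 r2; have [d hd] := cluster_variable_homogeneous cv.
    have Pb : cluster_pred (svar t2 i2) by apply/asboolP/In_var.
    by rewrite (sv2 i2); exact: (from2 (ClusterAlgebra Pb) d).
  have [[i1 _ ->]|[i2 _ ->]|->] := glue_cases i; [exact: lift1|exact: lift2|].
  by rewrite -(glue_idx1_x gr_xy); exact: lift1.
- have lift1 (f : fro A1) : exists2 t, segre t
      & theta t = psi (ratX K (glue_idx1 gr_xy (inr f)))^-1.
    have := from1 (frozen_exp K f (-1)) (-1 * grvec (inr f)).
    rewrite -exprN1 iota1E [val _]/= incl_mapXz; apply.
    exact/homogeneous_exp/homogeneousX.
  have lift2 (f : fro A2) : exists2 t, segre t
      & theta t = psi (ratX K (glue_idx2 gr_xy (inr f)))^-1.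
    have := from2 (frozen_exp K f (-1)) (-1 * grvec (inr f)).
    rewrite -exprN1 iota2E [val _]/= incl_mapXz; apply.
    exact/homogeneous_exp/homogeneousX.
  case: i => [[f|f]|].
  + by have := lift1 (val f); rewrite /= valK.
  + by have := lift2 (val f); rewrite /= valK.
  + by have := lift1 x; rewrite glue_idx1_x.
- exists (c *: tens 1 1); last by rewrite !linearZ_LR tens1 !rmorph1.
  apply: (@segre_of_comp _ _ _ _ _ 0); rewrite -[_ *: _]addr0.
  by apply: Segre_lin; [apply: Segre_tens; exact: homogeneous1 | exact: Segre_zero].
- by exists (t + u); [exact: segreD | rewrite !rmorphD /= tE uE].
- exists (t * u); last by rewrite !rmorphM /= tE uE.
  by apply: segreM => //; exact: ca_degM.
Qed.

(** The preimage of a (x) b is iota_1 a * iota_2 b * z ^ (- d): psi multiplies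
    iota_1 a by y ^ d and iota_2 b by x ^ d, and z is sent to x y. *)
Lemma theta_comp_psi d t : comp d t ->
  exists2 w : C, ca_deg d w & theta t = psi (val w).
Proof.
elim=> {t} [a b ha hb||c t u _ [v hv tE] _ [w hw uE]].
- have Aw : cluster_pred (A := A) (iota1 gr_xy (val a) * iota2 gr_xy (val b)
                                     * ratX K (glue_z gr_xy) ^ (- d)).
    apply/asboolP/In_mul; last exact/asboolP/(@frozen_exp_cluster_pred K A None).
    apply: In_mul; apply/asboolP.
      exact: (incl_map_pred (glue_incl1 gr_xy) (valP a)).
    exact: (incl_map_pred (glue_incl2 gr_xy) (valP b)).
  exists (ClusterAlgebra Aw).
    rewrite /ca_deg -{1}(addrK d d); apply: homogeneousM.
      apply: homogeneousM; first exact: (incl_map_homogeneous (glue_incl1 gr_xy) ha).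
      exact: (incl_map_homogeneous (glue_incl2 gr_xy) hb).
    have := homogeneous_exp (- d) (homogeneousX K (@grvec A) (glue_z gr_xy)).
    by rewrite [grvec _]deg_x mulr1.
  have wE := psi_MMXz (iota1 gr_xy (val a)) (iota2 gr_xy (val b)) (glue_z gr_xy) (- d).
  rewrite (psi_iota1 ha) (psi_iota2 hb) psi_z in wE.
  rewrite (mul_twist_cancel _ _ _ (ratX_neq0 K _) (ratX_neq0 K _)) in wE.
  by rewrite theta_tens -wE.
- by exists (0 : C); [exact: homogeneous0 | rewrite !raddf0].
- exists (c *: v + w).
    by apply: homogeneousD => //; exact: homogeneousZ.
  by rewrite !linearP /= tE uE.
Qed.

Lemma psi_cluster_algebra (a : C) : exists2 t, segre t & theta t = psi (val a).
Proof. by apply: psi_in_segre => //; exact/asboolP/(valP a). Qed.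

Definition glue_segre (a : C) : tensor C1 C2 := s2val (cid2 (psi_cluster_algebra a)).

Lemma glue_segre_in_segre a : segre (glue_segre a).
Proof. by rewrite /glue_segre; case: cid2. Qed.

Lemma theta_glue_segre a : theta (glue_segre a) = psi (val a).
Proof. by rewrite /glue_segre; case: cid2. Qed.

Lemma glue_segre_eq a t : theta t = psi (val a) -> glue_segre a = t.
Proof. by move=> tE; apply: theta_inj; rewrite theta_glue_segre. Qed.

Lemma glue_segre_inj : injective glue_segre.
Proof.
move=> a b ab; apply/val_inj/psi_inj.
by rewrite -2!theta_glue_segre ab.
Qed.

Lemma glue_segre_is_linear : linear glue_segre.
Proof.
move=> c a b; apply: glue_segre_eq.
by rewrite !linearP /= !theta_glue_segre.
Qed.

Lemma glue_segre_is_monoid_morphism : monoid_morphism glue_segre.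
Proof.
split=> [|a b]; apply: glue_segre_eq; first by rewrite !rmorph1.
by rewrite (tprod_is_monoid_morphism _ _).2 2!theta_glue_segre -psiM.
Qed.

HB.instance Definition _ :=
  GRing.isLinear.Build K C (tensor C1 C2) *:%R glue_segre glue_segre_is_linear.
HB.instance Definition _ :=
  GRing.isMonoidMorphism.Build C (tensor C1 C2) glue_segre
    glue_segre_is_monoid_morphism.

(** For a of degree d, phi a is a sum of elements of various components, each of
    which comes from an element of A of the corresponding degree.  These add up
    to a, which is homogeneous, so only those of degree d contribute. *)
Lemma glue_segre_comp d t : comp d t <-> exists2 a, ca_deg d a & glue_segre a = t.
Proof.
split=> [/theta_comp_psi[w hw tE]|[a ha <-]].
  by exists w; last exact: glue_segre_eq.
have [n [e [u [hu aE]]]] := glue_segre_in_segre a.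
have /choice[w wP] i : exists w : C, ca_deg (e i) w /\ theta (u i) = psi (val w).
  by have [w] := theta_comp_psi (hu i); exists w.
have valE : val a = \sum_i val (w i).
  apply: psi_inj.
  rewrite -theta_glue_segre aE [LHS]raddf_sum psi_sum.
  by apply: eq_bigr => i _; case: (wP i).
suff -> : glue_segre a = \sum_(i | e i == d) u i.
  by apply: segre_comp_sum => i /eqP <-; exact: hu.
apply: glue_segre_eq; rewrite valE (homogeneous_component (G := @grvec A) (d := e) (e := d)).
- by rewrite [LHS]raddf_sum psi_sum; apply: eq_bigr => i _; case: (wP i).
- by move=> i; case: (wP i).
- by rewrite -valE.
Qed.

Lemma glue_segre_image t : segre t <-> exists a, glue_segre a = t.
Proof.
split=> [[n [e [u [hu ->]]]]|[a <-]]; last exact: glue_segre_in_segre.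
have /choice[w wP] i : exists w, glue_segre w = u i.
  by have [/(_ (hu i))[w]] := glue_segre_comp (e i) (u i); exists w.
by exists (\sum_i w i); rewrite raddf_sum; apply: eq_bigr => i _; exact: wP.
Qed.

Lemma glue_segre_idx1 j :
  glue_segre (cvar K (glue_idx1 gr_xy j)) = tens (cvar K j) (frozen_exp K y (grvec j)).
Proof.
apply: glue_segre_eq; apply: etrans (esym (psi_idx1 j)).
by rewrite theta_tens; congr (_ * _); exact: renameXz.
Qed.

Lemma glue_segre_idx2 j :
  glue_segre (cvar K (glue_idx2 gr_xy j)) = tens (frozen_exp K x (grvec j)) (cvar K j).
Proof.
apply: glue_segre_eq; apply: etrans (esym (psi_idx2 j)).
by rewrite theta_tens [LHS]mulrC; congr (_ * _); exact: renameXz.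
Qed.

Lemma glue_segre_z :
  glue_segre (cvar K (glue_z gr_xy)) = tens (cvar K (inr x)) (cvar K (inr y)).
Proof. by apply: glue_segre_eq; exact: theta_z. Qed.

Lemma glue_segre_iota1 S u : is_cluster S -> u \in S ->
  exists (a : C1) (w : C), [/\ val a = u, val w = iota1 gr_xy u
    & glue_segre w = tens a (frozen_exp K y (degree (@grvec A1) u))].
Proof.
move=> cS uS; have cu : cluster_variable u by exists S.
have [d hd] := cluster_variable_homogeneous cu.
have Pu : cluster_pred u by apply/asboolP/In_var.
have Pw := incl_map_pred (glue_incl1 gr_xy) Pu.
exists (ClusterAlgebra Pu), (ClusterAlgebra Pw); split=> //.
apply: glue_segre_eq.
by case: (theta_iota1 (a := ClusterAlgebra Pu) (homogeneous_degree hd)).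
Qed.

Lemma glue_segre_iota2 S v : is_cluster S -> v \in S ->
  exists (b : C2) (w : C), [/\ val b = v, val w = iota2 gr_xy v
    & glue_segre w = tens (frozen_exp K x (degree (@grvec A2) v)) b].
Proof.
move=> cS vS; have cv : cluster_variable v by exists S.
have [d hd] := cluster_variable_homogeneous cv.
have Pv : cluster_pred v by apply/asboolP/In_var.
have Pw := incl_map_pred (glue_incl2 gr_xy) Pv.
exists (ClusterAlgebra Pv), (ClusterAlgebra Pw); split=> //.
apply: glue_segre_eq.
by case: (theta_iota2 (b := ClusterAlgebra Pv) (homogeneous_degree hd)).
Qed.

End GlueEmbedding.

Theorem theorem2p7 (K : fieldType) (A1 A2 : graded_datum)
    (x : fro A1) (y : fro A2)
    (deg_x : grvec (inr x) = 1) (deg_y : grvec (inr y) = 1) :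
  let deg_xy : grvec (inr x) = grvec (inr y) := etrans deg_x (esym deg_y) in
  let A := glue deg_xy in
  exists phi : {lrmorphism cluster_algebra K A ->
                  tensor (cluster_algebra K A1) (cluster_algebra K A2)},
  [/\ (* phi is an isomorphism of graded algebras onto the Segre product *)
      [/\ injective phi,
          forall t, segre (@ca_deg K A1) (@ca_deg K A2) t <->
            exists a, phi a = t
        & forall d t, segre_comp (@ca_deg K A1) (@ca_deg K A2) d t <->
            exists2 a, ca_deg d a & phi a = t],
      (* its values on the initial cluster *)
      [/\ forall j : idx A1, j != inr x ->
            phi (cvar K (glue_idx1 deg_xy j))
              = tens (cvar K j) (frozen_exp K y (grvec j)),
          forall j : idx A2, j != inr y ->
            phi (cvar K (glue_idx2 deg_xy j))
              = tens (frozen_exp K x (grvec j)) (cvar K j)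
        & phi (cvar K (glue_z deg_xy)) = tens (cvar K (inr x)) (cvar K (inr y))],
      (* the shape of the clusters of the glued algebra *)
      forall S, is_cluster (K := K) (A := A) S ->
        exists S1 S2, [/\ is_cluster S1, is_cluster S2
                        & S = box_cluster deg_xy S1 S2]
    & (* the values of phi on every cluster *)
      forall S1 S2, is_cluster S1 -> is_cluster S2 ->
        is_cluster (K := K) (A := A) (box_cluster deg_xy S1 S2) ->
        [/\ forall u, u \in S1 -> u != ratX K (inr x) ->
              exists (a : cluster_algebra K A1) (w : cluster_algebra K A),
                [/\ val a = u, val w = iota1 deg_xy u
                  & phi w = tens a (frozen_exp K y (degree (@grvec A1) u))],
            forall v, v \in S2 -> v != ratX K (inr y) ->
              exists (b : cluster_algebra K A2) (w : cluster_algebra K A),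
                [/\ val b = v, val w = iota2 deg_xy v
                  & phi w = tens (frozen_exp K x (degree (@grvec A2) v)) b]
          & phi (cvar K (glue_z deg_xy))
              = tens (cvar K (inr x)) (cvar K (inr y))]].
Proof.
move=> deg_xy A.
pose phi : {lrmorphism cluster_algebra K A ->
    tensor (cluster_algebra K A1) (cluster_algebra K A2)} :=
  glue_segre (gr_xy := deg_xy) deg_x deg_y.
exists phi; split.
- split; [exact: glue_segre_inj | exact: glue_segre_image | exact: glue_segre_comp].
- split=> [j _|j _|]; [exact: glue_segre_idx1 | exact: glue_segre_idx2 | exact: glue_segre_z].
- exact: glue_cluster_box.
- move=> S1 S2 c1 c2 _; split=> [u uS _|v vS _|]; last exact: glue_segre_z.
    exact: glue_segre_iota1 c1 uS.
  exact: glue_segre_iota2 c2 vS.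
Qed.
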